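(* Let $G$ be an infinite amenable countable discrete group and $X$ a compact metrizable space. Let $G\curvearrowright X$ be a minimal action that has the uniform Rokhlin property (URP) and comparison. Let $O_1$ and $O_2$ be nonempty open subsets of $X$ and $E$ a finite subset of $G$ containing $e$. Then the action is $(O_1,O_2,E)$-squarely divisible. In particular, the action is squarely divisible.
   Context: Actions are by homeomorphisms. $M_G(X)$ is the set of $G$-invariant Borel probability measures on $X$. $A^c$ denotes complement. For $V\subseteq X$ and $E\subseteq G$, $V^E=\bigcap_{s\in E}s^{-1}V$ and $EV=\bigcup_{s\in E}sV$. A finite set $F\subseteq G$ is $(E,\delta)$-invariant if $|\bigcap_{s\in E\cup\{e\}}s^{-1}F|\ge(1-\delta)|F|$. A tower is a pair $(S,B)$ with $S\subseteq G$ nonempty finite (the shape) and $B\subseteq X$ nonempty such that the sets $sB$, $s\in S$ (the levels) are pairwise disjoint. A castle is a finite collection $\{(S_k,V_k)\}_{k\in K}$ of towers with the sets $S_kV_k$ pairwise disjoint; its remainder is $X\setminus\bigsqcup_kS_kV_k$; it is open if all levels are open. URP: for every finite $E\subseteq G$ and $\delta>0$ there is an open castle with $(E,\delta)$-invariant shapes whose remainder $R$ satisfies $\sup_{\mu\in M_G(X)}\mu(R)<\delta$. Subequivalence: for $A\subseteq X$ closed and $B\subseteq X$ open, $A\prec B$ means there are open sets $U_1,\dots,U_n\subseteq X$ and $s_1,\dots,s_n\in G$ with $A\subseteq\bigcup_iU_i$ and the sets $s_iU_i$ pairwise disjoint subsets of $B$. Comparison: $A\prec B$ for all closed $A$ and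 open $B$ with $\mu(A)<\mu(B)$ for every $\mu\in M_G(X)$. Sets $V_1,\dots,V_M\subseteq X$ are pairwise equivalent if there are finitely many Borel sets $\{C_k\}_{k\in K}$ with $V_1=\bigsqcup_kC_k$ and elements $s_{k,m}\in G$ ($k\in K$, $1\le m\le M$) with $s_{k,1}=e$ such that $V_m=\bigsqcup_ks_{k,m}C_k$ for all $m$ and the sets $s_{k,m}C_k$, over all $k$ and $m$, have pairwise disjoint closures. The members of a collection $\mathscr V$ of subsets of $X$ are pairwise $E$-disjoint if the sets $E\overline V$, $V\in\mathscr V$, are pairwise disjoint. Let $O_1,O_2\subseteq X$ be open and $E\subseteq G$ finite with $e\in E$. The action is $(O_1,O_2,E)$-squarely divisible if there exist $n\in\mathbb N$, a collection $\{V_{i,j}\}_{i,j=1}^n$ of pairwise equivalent and pairwise $E$-disjoint open subsets of $X$ and, writing $V=\bigsqcup_{i,j}V_{i,j}$, an open set $U\supseteq\partial V$ such that, with $V_1=\bigsqcup_{i=1}^nV_{i,1}$, $R=V^c$, and $B=\overline V\cap((V\cap\overline U^c)^E)^c$: (i) $\overline{V_{i,1}}\prec O_1\cap\bigsqcup_{j=2}^nV_{i,j}\cap B^c$ for every $i=1,\dots,n$; (ii) $R\prec O_2\cap V\cap(V_1\cup B)^c$; (iii) $B\cup(\overline U\cap R)\prec O_2\cap\overline{V\cup U}^c$. For a nonempty open $O\subseteq X$, the action is $O$-squarely divisible if there are nonempty open sets $O_0\subseteq O$ and $O_1,O_2\subseteq X$, the three having pairwise disjoint closures, such that $\overline{O_1}\sqcup\overline{O_2}\prec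 O_0$ and the action is $(O_1,O_2,E)$-squarely divisible for all finite $E\subseteq G$ containing $e$. The action is squarely divisible if it is $O$-squarely divisible for every nonempty open $O\subseteq X$. *)

(* Defs.v *)
From HB Require Import structures.
From mathcomp Require Import all_boot all_order all_algebra finmap.
From mathcomp Require Import all_classical all_reals all_analysis.

Set Implicit Arguments.
Unset Strict Implicit.
Unset Printing Implicit Defensive.

Import Order.TTheory GRing.Theory Num.Theory.

Local Open Scope classical_set_scope.
Local Open Scope ring_scope.

(* An action of the discrete group G on X by homeomorphisms; the inverse of
   [act s] is [act s^-1], so continuity of every [act s] is enough. *)
Record topAction (G : groupType) (X : topologicalType) := TopAction {
  act :> G -> X -> X;
  act1 : forall x, act 1%g x = x;
  actM : forall s t x, act (s * t)%g x = act s (act t x);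
  act_continuous : forall s, continuous (act s) }.

(* Existence of a left-invariant finitely additive probability measure defined
   on all subsets of the discrete group G. *)
Definition amenable (R : realType) (G : groupType) : Prop :=
  exists m : set G -> R,
    [/\ forall A, 0 <= m A,
        m [set: G] = 1,
        forall A B, A `&` B = set0 -> m (A `|` B) = m A + m B &
        forall s A, m [set (s * g)%g | g in A] = m A].

(* The set whose cardinality is taken is the intersection of the s^-1 F over
   s in E or s = 1: g lies in s^-1 F iff s g lies in F, and s = 1 gives
   g \in F. *)
Definition approx_invariant (R : realType) (G : groupType)
    (E : {fset G}) (delta : R) (F : {fset G}) : Prop :=
  (1 - delta) * (#|` F|)%:R <=
    (#|` [fset g in F | all (fun s => (s * g)%g \in F) E]%fset|)%:R.

Definition boundary (X : topologicalType) (A : set X) : set X :=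
  closure A `\` interior A.

Section Action.
Context (G : groupType) (X : topologicalType) (a : topAction G X).

Definition minimal_action : Prop :=
  forall A : set X, closed A -> A !=set0 ->
    (forall s, a s @` A `<=` A) -> A = [set: X].

(* V^E *)
Definition inter_translates (V : set X) (E : {fset G}) : set X :=
  \bigcap_(s in [set` E]) (a (s^-1)%g @` V).

(* E V *)
Definition union_translates (E : {fset G}) (V : set X) : set X :=
  \bigcup_(s in [set` E]) (a s @` V).

Definition is_tower (S : {fset G}) (B : set X) : Prop :=
  [/\ S != fset0, B !=set0 & trivIset [set` S] (fun s => a s @` B)].

Definition is_castle (n : nat) (S : 'I_n -> {fset G}) (V : 'I_n -> set X) :
    Prop :=
  (forall k, is_tower (S k) (V k)) /\
  trivIset [set: 'I_n] (fun k => union_translates (S k) (V k)).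

Definition open_castle (n : nat) (S : 'I_n -> {fset G}) (V : 'I_n -> set X) :
    Prop :=
  is_castle S V /\ forall k s, s \in S k -> open (a s @` V k).

Definition castle_remainder (n : nat) (S : 'I_n -> {fset G})
    (V : 'I_n -> set X) : set X :=
  ~` \bigcup_k union_translates (S k) (V k).

(* Meant for A closed and B open; it is only used in that situation. *)
Definition subequivalent (A B : set X) : Prop :=
  exists (n : nat) (U : 'I_n -> set X) (s : 'I_n -> G),
    [/\ forall i, open (U i),
        A `<=` \bigcup_i U i,
        trivIset [set: 'I_n] (fun i => a (s i) @` U i) &
        forall i, a (s i) @` U i `<=` B].

(* The family V is indexed by I, and i0 is the index playing the role of the
   first one. Disjointness of the unions is part of the last clause. *)
Definition pairwise_equivalent (I : finType) (i0 : I) (V : I -> set X) :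
    Prop :=
  exists (K : nat) (C : 'I_K -> set X) (s : 'I_K -> I -> G),
    [/\ forall k, <<s @open X >> (C k),
        V i0 = \bigcup_k C k,
        forall k, s k i0 = 1%g,
        forall i, V i = \bigcup_k (a (s k i) @` C k) &
        trivIset [set: 'I_K * I]
          (fun p => closure (a (s p.1 p.2) @` C p.1))].

Definition pairwise_disjoint_wrt (E : {fset G}) (I : Type) (V : I -> set X) :
    Prop :=
  trivIset [set: I] (fun i => union_translates E (closure (V i))).

(* The indices 1, ..., n of the mathematical definition are the elements of
   'I_n.+1 here, with ord0 for the index 1. *)
Definition squarely_divisible_for (O1 O2 : set X) (E : {fset G}) : Prop :=
  exists (n : nat) (V_ : 'I_n.+1 -> 'I_n.+1 -> set X) (U : set X),
    let V := \bigcup_(p : 'I_n.+1 * 'I_n.+1) V_ p.1 p.2 in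
    let V1 := \bigcup_i V_ i ord0 in
    let R := ~` V in
    let B := closure V `&` ~` inter_translates (V `&` ~` closure U) E in
    [/\ [/\ forall i j, open (V_ i j),
            pairwise_equivalent (ord0, ord0) (fun p => V_ p.1 p.2) &
            pairwise_disjoint_wrt E
              (fun p : 'I_n.+1 * 'I_n.+1 => V_ p.1 p.2)],
        open U /\ boundary V `<=` U,
        forall i, subequivalent (closure (V_ i ord0))
          (O1 `&` \bigcup_(j in [set j | j != ord0]) V_ i j `&` ~` B),
        subequivalent R (O2 `&` V `&` ~` (V1 `|` B)) &
        subequivalent (B `|` (closure U `&` R))
          (O2 `&` ~` closure (V `|` U))].

Definition squarely_divisible_in (O : set X) : Prop :=
  exists O0 O1 O2 : set X,
    [/\ [/\ open O0, open O1 & open O2],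
        [/\ O0 !=set0, O1 !=set0 & O2 !=set0],
        O0 `<=` O,
        [/\ closure O0 `&` closure O1 = set0,
            closure O0 `&` closure O2 = set0 &
            closure O1 `&` closure O2 = set0] &
        subequivalent (closure O1 `|` closure O2) O0 /\
        forall E : {fset G}, 1%g \in E -> squarely_divisible_for O1 O2 E].

Definition squarely_divisible : Prop :=
  forall O : set X, open O -> O !=set0 -> squarely_divisible_in O.

End Action.

Section Measures.
Context (R : realType) (G : groupType) (X : ptopologicalType)
  (a : topAction G X).

Definition borel_probability := probability (g_sigma_algebraType (@open X)) R.

Definition invariant_measures : set borel_probability :=
  [set mu | forall s (A : set X), <<s @open X >> A ->
              mu (a s @` A) = mu A].

(* If there is no invariant measure the supremum is -oo. *)
Definition uniform_Rokhlin : Prop :=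
  forall (E : {fset G}) (delta : R), 0 < delta ->
    exists (n : nat) (S : 'I_n -> {fset G}) (V : 'I_n -> set X),
      [/\ open_castle a S V,
          forall k, approx_invariant E delta (S k) &
          (ereal_sup [set (mu : borel_probability) (castle_remainder a S V)
                     | mu in invariant_measures] < delta%:E)%E].

Definition has_comparison : Prop :=
  forall A B : set X, closed A -> open B ->
    (forall mu : borel_probability, invariant_measures mu ->
       (mu A < mu B)%E) ->
    subequivalent a A B.

End Measures.

(* Main.v *)
(** The towers of an open castle with very invariant shapes are cut into
    equivalent pieces by cutting their shapes. Given a shape [S], averaging over
    one invariant measure yields a point [x] whose [S]-orbit segment mostly
    avoids the remainder of a fixed auxiliary castle with shapes [Q j], so the
    visits of [x] to the bases tile most of [S] by right translates of the
    [Q j]. Dealing out equally many tiles of each type to [n^2 + 1] classes gives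
    equinumerous, approximately invariant subsets [T c] of [S]; [n^2] of them
    define the array [V_ i j], and the remaining one is left free as room for
    (iii). If finitely many translates [f^-1 O], [f \in F], cover [X], a nearly
    [F]-invariant [T c] carries a proportion of [O] of order [1 / #|F|],
    whatever the invariant measure, so that comparison applies when [n] is large
    with respect to [#|F|].

    Weak-* compactness is never needed: a closed set whose measure is below the
    infimum of that of a small open set [O] is subequivalent to [O], and so has a
    neighbourhood of small measure. Likewise an invariant measure exists because
    otherwise comparison would make [X] subequivalent to the empty set. *)
Require Import Defs.
From mathcomp Require Import all_boot all_order all_algebra finmap.
From mathcomp Require Import all_classical all_reals all_analysis.
From mathcomp Require Import measurable_realfun ring lra zify.

Set Implicit Arguments.
Unset Strict Implicit.
Unset Printing Implicit Defensive.

Import Order.TTheory GRing.Theory Num.Theory.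

Local Open Scope classical_set_scope.
Local Open Scope ring_scope.

Lemma closure_min (X : topologicalType) (A C : set X) :
  closed C -> A `<=` C -> closure A `<=` C.
Proof. by move=> /closure_id {2}-> /closureS. Qed.

(** * Translates of sets under the action *)

Section Actions.
Context (G : groupType) (X : topologicalType) (a : topAction G X).
Implicit Types (s t : G) (A B : set X).

Lemma actVK s x : a (s^-1)%g (a s x) = x.
Proof. by rewrite -actM mulVg act1. Qed.

Lemma actKV s x : a s (a (s^-1)%g x) = x.
Proof. by rewrite -actM mulgV act1. Qed.

Lemma act_inj s : injective (a s).
Proof. exact: can_inj (actVK s). Qed.

Lemma act_imageE s A : a s @` A = a (s^-1)%g @^-1` A.
Proof.
apply/seteqP; split=> x /=; first by case=> y Ay <-; rewrite actVK.
by move=> Ax; exists (a (s^-1)%g x) => //; rewrite actKV.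
Qed.

Lemma act_imageM s t A : a s @` (a t @` A) = a (s * t)%g @` A.
Proof.
by rewrite !act_imageE; apply/seteqP; split=> x /=; rewrite -actM invgM.
Qed.

Lemma act_image1 A : a 1%g @` A = A.
Proof.
by rewrite act_imageE invg1; apply/seteqP; split=> x /=; rewrite act1.
Qed.

Lemma open_act s A : open A -> open (a s @` A).
Proof.
by rewrite act_imageE; apply: open_comp => x _; exact: act_continuous.
Qed.

Lemma closed_act s A : closed A -> closed (a s @` A).
Proof.
by rewrite act_imageE; apply: closed_comp => x _; exact: act_continuous.
Qed.

Lemma subset_closure_act s A : closure (a s @` A) `<=` a s @` closure A.
Proof.
apply: closure_min; first exact/closed_act/closed_closure.
exact/image_subset/subset_closure.
Qed.

End Actions.

(** * Finite subsets of the group: cores, products, tiles *)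

Section Tiles.
Context (G : groupType).
Implicit Types (E K S : {fset G}).

(** This is literally the set counted in [approx_invariant], so the two fold into each other by
    conversion. *)
Definition core E S : {fset G} :=
  [fset g in S | all (fun s => (s * g)%g \in S) E]%fset.

Lemma coreP E S g :
  reflect (g \in S /\ forall s, s \in E -> (s * g)%g \in S) (g \in core E S).
Proof. by rewrite !inE; apply: (iffP andP) => -[gS /allP]. Qed.

Lemma core_sub E S : (core E S `<=` S)%fset.
Proof. by apply/fsubsetP => g /coreP[]. Qed.

Definition mulfs E S : {fset G} := [fset (x * y)%g | x in E, y in S]%fset.

Lemma mulfsP E S g :
  reflect (exists x y, [/\ x \in E, y \in S & g = (x * y)%g]) (g \in mulfs E S).
Proof.
apply: (iffP (imfset2P _ _ _ _ _)) => /=.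
  by case=> x xE [y yS ->]; exists x, y.
by case=> x [y [xE yS ->]]; exists x => //; exists y.
Qed.

Lemma mem_mulfs E S x y : x \in E -> y \in S -> (x * y)%g \in mulfs E S.
Proof. by move=> xE yS; apply/mulfsP; exists x, y. Qed.

Lemma card_mulfs E S :
  (forall x y x' y', x \in E -> x' \in E -> y \in S -> y' \in S ->
     (x * y = x' * y')%g -> x = x' /\ y = y') ->
  (#|` mulfs E S| = #|` E| * #|` S|)%N.
Proof.
move=> inj; pose r := [seq (x * y)%g | x <- E, y <- S].
have -> : mulfs E S = [fset g in r]%fset.
  apply/fsetP => g; rewrite !inE; apply/mulfsP/allpairsP => /=.
    by case=> x [y [xE yS ->]]; exists (x, y).
  by case=> -[x y] [xE yS ->]; exists x, y.
rewrite card_fseq undup_id ?size_allpairs //.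
apply: allpairs_uniq => [||[x y] [x' y']]; rewrite ?fset_uniq //.
case/allpairsP => -[u v] [/= uE vS [-> ->]].
case/allpairsP => -[u' v'] [/= uE' vS' [-> ->]].
by case/inj => // -> ->.
Qed.

(** Since [d < 1], the core contains some [g], and the right translate [K g] is then a copy of [K]
    inside [S]. This is how shapes are forced to be large. *)
Lemma leq_card_invariant (R : realType) K S (d : R) :
  d < 1 -> S != fset0 -> approx_invariant K d S -> (#|` K| <= #|` S|)%N.
Proof.
move=> d1 S0 KS.
have S_gt0 : (0 < #|` S|)%N by rewrite cardfs_gt0.
have : (0 : R) < #|` core K S|%:R.
  by apply: lt_le_trans KS; rewrite mulr_gt0 ?ltr0n // subr_gt0.
rewrite ltr0n cardfs_gt0 => /fset0Pn[g /coreP[_ Kg]].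
have <- : #|` [fset (s * g)%g | s in K]%fset| = #|` K|.
  by rewrite card_imfset //=; exact: mulIg.
by apply/fsubset_leq_card/fsubsetP => _ /imfsetP[s /= sK ->]; exact: Kg.
Qed.

(** The enumeration of [A] is cut into consecutive blocks of length [q], one for each rank in [C];
    the elements left over after division are dropped. *)
Lemma fset_equipartition (T : choiceType) (C : finType) (A : {fset T}) :
  exists f : C -> {fset T},
    [/\ forall c, (f c `<=` A)%fset,
        forall c d x, x \in f c -> x \in f d -> c = d &
        forall c, #|` f c| = (#|` A| %/ #|C|)%N].
Proof.
set q := (#|` A| %/ #|C|)%N; case: (fset_0Vmem A) => [A0|[x0 _]].
  exists (fun=> fset0); split => // c; rewrite cardfs0 /q A0 cardfs0 div0n //.
pose s := enum_fset A; have us : uniq s by exact: fset_uniq.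
have ltA (c : C) i : i \in iota 0 q -> (enum_rank c * q + i < size s)%N.
  rewrite mem_iota /= add0n => iq.
  apply: leq_trans (leq_divM #|` A| #|C|); rewrite -/q.
  apply: (@leq_trans ((enum_rank c).+1 * q)%N).
    by rewrite mulSn addnC ltn_add2r.
  by rewrite mulnC leq_mul2l ltn_ord orbT.
exists (fun c => [fset nth x0 s (enum_rank c * q + i) | i in iota 0 q]%fset).
split => [c|c d x|c].
- by apply/fsubsetP => _ /imfsetP[i /ltA iA ->]; exact: mem_nth.
- case/imfsetP => i /= iq -> /imfsetP[j /= jq /eqP].
  rewrite nth_uniq ?ltA // => /eqP e; apply/enum_rank_inj/ord_inj.
  move: iq jq; rewrite !mem_iota /= !add0n => iq jq.
  have : ((enum_rank c * q + i) %/ q = (enum_rank d * q + j) %/ q)%N by rewrite e.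
  have q_gt0 : (0 < q)%N by exact: leq_ltn_trans iq.
  by rewrite !divnMDl // !divn_small // !addn0.
- rewrite card_in_imfset /=.
    by rewrite undup_id ?iota_uniq // size_iota.
  move=> i j iq jq /eqP; rewrite nth_uniq ?ltA // eqn_add2l => /eqP //.
Qed.

Section TileFamily.
Context (J : finType).
Implicit Types Q Z : J -> {fset G}.

Definition tiles Q Z : {fset G} :=
  (\big[fsetU/fset0]_(j : J) mulfs (Q j) (Z j))%fset.

Lemma tilesP Q Z g :
  reflect (exists j t z, [/\ t \in Q j, z \in Z j & g = (t * z)%g])
    (g \in tiles Q Z).
Proof.
apply: (iffP (bigfcupP _ _ _ _)).
  by case=> j _ /mulfsP[t [z [tQ zZ ->]]]; exists j, t, z.
case=> j [t [z [tQ zZ ->]]]; exists j; rewrite ?mem_index_enum //.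
exact: mem_mulfs.
Qed.

(** In other words, the tiles, which are the right translates [Q j z] with [z] in [Z j], are
    pairwise disjoint. *)
Definition tiles_inj Q Z := forall j t z j' t' z',
  t \in Q j -> z \in Z j -> t' \in Q j' -> z' \in Z j' ->
  (t * z = t' * z')%g -> [/\ j = j', t = t' & z = z'].

Lemma card_tiles Q Z : tiles_inj Q Z ->
  #|` tiles Q Z| = (\sum_j #|` Q j| * #|` Z j|)%N.
Proof.
move=> inj.
have {}inj j : #|` mulfs (Q j) (Z j)| = (#|` Q j| * #|` Z j|)%N /\
    (forall j', j != j' -> [disjoint mulfs (Q j) (Z j) & mulfs (Q j') (Z j')])%fset.
  split.
    apply: card_mulfs => x y x' y' xQ xQ' yZ yZ' e.
    by have [] := inj _ _ _ _ _ _ xQ yZ xQ' yZ' e.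
  move=> j' jj'; apply/fdisjointP => g /mulfsP[t [z [tQ zZ ->]]].
  apply/negP => /mulfsP[t' [z' [tQ' zZ' e]]].
  by have [ejj'] := inj _ _ _ _ _ _ tQ zZ tQ' zZ' e; rewrite ejj' eqxx in jj'.
rewrite /tiles; elim: (index_enum J) (index_enum_uniq J) => [|j r IH] /=.
  by rewrite !big_nil cardfs0.
case/andP => jr ur; rewrite !big_cons cardfsU IH // (inj j).1.
suff /eqP -> : (mulfs (Q j) (Z j) `&`
    \big[fsetU/fset0]_(j0 <- r) mulfs (Q j0) (Z j0) == fset0)%fset.
  by rewrite cardfs0 subn0.
rewrite fsetI_eq0; apply/fdisjointP => g gj; apply/negP.
case/bigfcupP => j' /andP[jr' _] gj'.
have jj' : j != j' by apply: contraNneq jr => ->.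
by have /fdisjointP/(_ _ gj)/negP := (inj j).2 _ jj'.
Qed.

End TileFamily.
End Tiles.

(** * Unions of levels over chosen parts of shapes and bases *)

Section Parts.
Context (G : groupType) (X : topologicalType) (a : topAction G X) (n : nat).
Implicit Types (S P : 'I_n -> {fset G}) (V A B : 'I_n -> set X).

(** Shapes and bases are separate parameters because the construction both cuts the shapes of one
    castle and shrinks its bases. *)
Definition levels P A : set X := \bigcup_k union_translates a (P k) (A k).

Lemma levelsP P A x :
  levels P A x <-> exists k t y, [/\ t \in P k, A k y & x = a t y].
Proof.
split; first by case=> k _ [t tP [y Ay <-]]; exists k, t, y.
by case=> k [t [y [tP Ay ->]]]; exists k => //; exists t => //; exists y.
Qed.

(** Pointwise form of the disjointness in a castle: a point of the castle determines its tower, its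
    level and its base point. *)
Definition levels_disjoint S V := forall k t y k' t' y',
  t \in S k -> V k y -> t' \in S k' -> V k' y' -> a t y = a t' y' ->
  [/\ k = k', t = t' & y = y'].

Lemma castle_levels_disjoint S V : is_castle a S V -> levels_disjoint S V.
Proof.
case=> tow disj k t y k' t' y' tS Vy tS' Vy' e.
have kk' : k = k'.
  apply: disj => //; exists (a t y); split; first by exists t => //; exists y.
  by exists t' => //; exists y'.
subst k'; have tt' : t = t'.
  have [_ _ tr] := tow k; apply: tr => //; exists (a t y).
  by split; [exists y|exists y'].
by subst t'; split=> //; exact: act_inj e.
Qed.

Lemma open_levels P A : (forall k, open (A k)) -> open (levels P A).
Proof.
by move=> oA; apply: bigcup_open => k _; apply: bigcup_open => t _; exact: open_act.
Qed.

Lemma closed_levels P A : (forall k, closed (A k)) -> closed (levels P A).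
Proof.
move=> cA; apply: closed_bigcup => [|k _]; first exact: finite_finset.
by apply: closed_bigcup => [|t _]; [exact: finite_fset|exact: closed_act].
Qed.

Lemma levels_sub P P' A A' : (forall k, (P k `<=` P' k)%fset) ->
  (forall k, A k `<=` A' k) -> levels P A `<=` levels P' A'.
Proof.
move=> PP' AA' x /levelsP[k [t [y [tP Ay ->]]]]; apply/levelsP; exists k, t, y.
by split => //; [exact: (fsubsetP (PP' k))|exact: AA'].
Qed.

Lemma levels_subl P P' A : (forall k, (P k `<=` P' k)%fset) ->
  levels P A `<=` levels P' A.
Proof. by move=> PP'; apply: levels_sub => // k; exact: subset_refl. Qed.

Lemma levels_subr P A A' : (forall k, A k `<=` A' k) -> levels P A `<=` levels P A'.
Proof. by move=> AA'; apply: levels_sub => // k; exact: fsubset_refl. Qed.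

Lemma closure_levels P A :
  closure (levels P A) `<=` levels P (fun k => closure (A k)).
Proof.
apply: closure_min; first by apply: closed_levels => k; exact: closed_closure.
by apply: levels_sub => // k; exact: subset_closure.
Qed.

End Parts.

(** * Borel sets and real-valued masses of invariant measures *)

Section Measure.
Context (R : realType) (G : groupType) (X : ptopologicalType)
  (a : topAction G X).
Implicit Types (A B : set X) (F S : {fset G}).

Definition borel A : Prop := <<s @open X >> A.

Lemma borel_open A : open A -> borel A.
Proof. exact: sub_sigma_algebra. Qed.

Lemma borelC A : borel A -> borel (~` A).
Proof. exact: (@measurableC _ (g_sigma_algebraType (@open X)) A). Qed.

Lemma borel_closed A : closed A -> borel A.
Proof.
by move=> cA; rewrite -[A]setCK; apply: borelC; apply: borel_open; exact: closed_openC.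
Qed.

Lemma borelU A B : borel A -> borel B -> borel (A `|` B).
Proof. exact: (@measurableU _ (g_sigma_algebraType (@open X)) A B). Qed.

Lemma borel_bigcup (I : choiceType) (D : set I) (A : I -> set X) :
  finite_set D -> (forall i, D i -> borel (A i)) -> borel (\bigcup_(i in D) A i).
Proof.
exact: (@fin_bigcup_measurable _ (g_sigma_algebraType (@open X)) I D A).
Qed.

Lemma borel_act s A : borel A -> borel (a s @` A).
Proof.
rewrite act_imageE => bA.
have : measurable_fun [set: g_sigma_algebraType (@open X)]
    (a (s^-1)%g : g_sigma_algebraType (@open X) -> g_sigma_algebraType (@open X)).
  apply: (@measurability _ _ (g_sigma_algebraType (@open X))
    (g_sigma_algebraType (@open X)) setT (a s^-1%g) (@open X)) => //=.
  move=> _ [U oU <-]; rewrite setTI; apply: borel_open.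
  by apply: open_comp => // x _; exact: act_continuous.
by move=> /(_ measurableT A bA); rewrite setTI.
Qed.

Lemma borel_levels n (P : 'I_n -> {fset G}) (A : 'I_n -> set X) :
  (forall k, borel (A k)) -> borel (levels a P A).
Proof.
move=> bA; apply: borel_bigcup => [|k _]; first exact: finite_finset.
by apply: borel_bigcup => [|t _]; [exact: finite_fset|exact: borel_act].
Qed.

Definition mass (mu : borel_probability R X) A : R := fine (mu A).

Section Mass.
Context (mu : borel_probability R X).

Lemma massE A : borel A -> mu A = (mass mu A)%:E.
Proof. by move=> bA; rewrite /mass fineK // fin_num_measure. Qed.

Lemma mass_ge0 A : 0 <= mass mu A.
Proof. exact: fine_ge0. Qed.

Lemma mass_setT : mass mu setT = 1.
Proof. by rewrite /mass probability_setT. Qed.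

Lemma mass_lt A B : borel A -> borel B -> (mu A < mu B)%E = (mass mu A < mass mu B).
Proof. by move=> bA bB; rewrite !massE // lte_fin. Qed.

Lemma mass_le A B : borel A -> borel B -> A `<=` B -> mass mu A <= mass mu B.
Proof.
by move=> bA bB AB; rewrite -lee_fin -!massE // le_measure // inE.
Qed.

Lemma mass_setC A : borel A -> mass mu (~` A) = 1 - mass mu A.
Proof.
move=> bA; apply: EFin_inj; rewrite -massE; last exact: borelC.
by rewrite probability_setC // massE // EFinB.
Qed.

Lemma mass_bigcup (I : choiceType) (D : seq I) (A : I -> set X) : uniq D ->
  (forall i, i \in D -> borel (A i)) -> trivIset [set` D] A ->
  mass mu (\bigcup_(i in [set` D]) A i) = \sum_(i <- D) mass mu (A i).
Proof.
move=> uD bA dA; apply: EFin_inj; rewrite -massE; last exact: borel_bigcup.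
rewrite measure_fin_bigcup // -fsbig_seq //= -sumEFin.
rewrite big_seq_cond [RHS]big_seq_cond.
by apply: eq_bigr => i; rewrite andbT => iD; rewrite massE //; exact: bA.
Qed.

Lemma mass_sub_bigcup (I : choiceType) (D : seq I) (A : I -> set X) B : uniq D ->
  (forall i, i \in D -> borel (A i)) -> borel B ->
  B `<=` \bigcup_(i in [set` D]) A i ->
  mass mu B <= \sum_(i <- D) mass mu (A i).
Proof.
move=> uD bA bB BA; rewrite -lee_fin -massE //.
have /le_trans -> // : (mu B <= \sum_(i \in [set` D]) mu (A i))%E.
  exact: content_sub_fsum.
rewrite -fsbig_seq //= -sumEFin big_seq_cond [leRHS]big_seq_cond.
by apply: lee_sum => i; rewrite andbT => iD; rewrite massE //; exact: bA.
Qed.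

End Mass.

Context (mu : borel_probability R X) (mu_inv : invariant_measures a mu).

Lemma mass_act s A : borel A -> mass mu (a s @` A) = mass mu A.
Proof. by move=> bA; rewrite /mass mu_inv. Qed.

(** The translates [f^-1 B], for [f] in [F], cover [A], and each has the mass of [B]. *)
Lemma mass_cover F A B : borel A -> borel B ->
  (forall x, A x -> exists2 f, f \in F & B (a f x)) ->
  mass mu A <= #|` F|%:R * mass mu B.
Proof.
move=> bA bB cov.
have -> : #|` F|%:R * mass mu B = \sum_(f <- F) mass mu (a (f^-1)%g @` B).
  rewrite (eq_bigr (fun=> mass mu B)); last by move=> f _; rewrite mass_act.
  by rewrite big_const_seq count_predT iter_addr_0 mulr_natl.
apply: mass_sub_bigcup => // [f _|x /cov[f fF Bfx]]; first exact: borel_act.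
by exists f => //; rewrite act_imageE invgK.
Qed.

Lemma mass_levels n (S P : 'I_n -> {fset G}) (V Z : 'I_n -> set X) :
  levels_disjoint a S V -> (forall k, (P k `<=` S k)%fset) ->
  (forall k, Z k `<=` V k) -> (forall k, borel (Z k)) ->
  mass mu (levels a P Z) = \sum_k #|` P k|%:R * mass mu (Z k).
Proof.
move=> sep PS ZV bZ.
have -> : levels a P Z = \bigcup_(k in [set` enum 'I_n])
    union_translates a (P k) (Z k).
  by rewrite /levels; congr bigcup; apply/seteqP; split=> k //= _; rewrite mem_enum.
rewrite mass_bigcup ?enum_uniq //.
- rewrite big_enum /=; apply: eq_bigr => k _.
  rewrite /union_translates mass_bigcup ?fset_uniq //.
  + rewrite (eq_bigr (fun=> mass mu (Z k))); last by move=> f _; rewrite mass_act.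
    by rewrite big_const_seq count_predT iter_addr_0 mulr_natl.
  + by move=> t _; exact: borel_act.
  + move=> t t' tP tP' [x [[y Zy <-] [y' Zy' e]]].
    have [] := sep k t' y' k t y => //.
    * exact: (fsubsetP (PS k)).
    * exact: ZV.
    * exact: (fsubsetP (PS k)).
    * exact: ZV.
- by move=> k _; apply: borel_bigcup => // t _; exact: borel_act.
- move=> k k' _ _ [x [[t tP [y Zy <-]] [t' tP' [y' Zy' e]]]].
  have [] := sep k' t' y' k t y => //.
  + exact: (fsubsetP (PS k')).
  + exact: ZV.
  + exact: (fsubsetP (PS k)).
  + exact: ZV.
Qed.

End Measure.

(** * Compactness, minimality, and averaging over an invariant measure *)

Lemma closure_meets_open (X : topologicalType) (A U : set X) x :
  open U -> U x -> closure A x -> A `&` U !=set0.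
Proof. by move=> oU Ux; apply; exact: open_nbhs_nbhs. Qed.

Lemma compact_shrink (X : topologicalType) (A U : set X) :
  hausdorff_space X -> compact [set: X] -> closed A -> open U -> A `<=` U ->
  exists C, [/\ open C, A `<=` C & closure C `<=` U].
Proof.
move=> hX cX cA oU AU.
have [|C AC CU] := @compact_normal X hX cX A cA U.
  by move=> x /AU Ux; exact: open_nbhs_nbhs.
exists C°; split=> //; first exact: open_interior.
by apply: subset_trans CU; apply: closureS; exact: interior_subset.
Qed.

Section Dynamics.
Context (R : realType) (G : groupType) (X : ptopologicalType)
  (a : topAction G X).
Implicit Types (A B O : set X) (F K S : {fset G}).

(** The points whose orbit misses [O] form a closed invariant set, which minimality makes empty;
    compactness then leaves finitely many translates. *)
Lemma minimal_cover O : compact [set: X] -> minimal_action a ->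
  open O -> O !=set0 ->
  exists F : {fset G}, forall x, exists2 f, f \in F & O (a f x).
Proof.
move=> cX minX oO [x0 Ox0].
have cov x : exists g, O (a g x).
  apply: contrapT => nO.
  have : ~` (\bigcup_(g in [set: G]) (a g @^-1` O)) = setT.
    apply: minX.
    - apply: open_closedC; apply: bigcup_open => g _.
      by apply: open_comp => // y _; exact: act_continuous.
    - by exists x => -[g _ Og]; apply: nO; exists g.
    - move=> s _ [y ny <-] [g _ /= Og]; apply: ny; exists (g * s)%g => //=.
      by rewrite actM.
  move/seteqP=> [_ /(_ x0 I)]; apply; exists 1%g => //=.
  by rewrite act1.
move: cX; rewrite compact_cover => /(_ G setT (fun g => a g @^-1` O)).
case=> [g _|x _|F _ FX].
- by apply: open_comp => // y _; exact: act_continuous.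
- by have [g Og] := cov x; exists g.
- by exists F => x; have [f] := FX x I; exists f.
Qed.

(** The open sets witnessing the subequivalence form the neighbourhood: their translates are
    disjoint inside [B], and invariance preserves their masses. *)
Lemma subequivalent_nbhd A B : open B -> subequivalent a A B ->
  exists W, [/\ open W, A `<=` W & forall mu : borel_probability R X,
    invariant_measures a mu -> mass mu W <= mass mu B].
Proof.
move=> oB [n [U [s [oU AU dU UB]]]]; exists (\bigcup_i U i); split => //.
  by apply: bigcup_open => i _; exact: oU.
move=> mu mu_inv.
have UE (V : 'I_n -> set X) : \bigcup_i V i = \bigcup_(i in [set` enum 'I_n]) V i.
  by congr bigcup; apply/seteqP; split=> k //= _; rewrite mem_enum.
rewrite UE.
apply: (@le_trans _ _ (\sum_(i <- enum 'I_n) mass mu (a (s i) @` U i))).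
  rewrite (eq_bigr (fun i => mass mu (U i))).
    apply: mass_sub_bigcup => //; first exact: enum_uniq.
      by move=> i _; apply: borel_open; exact: oU.
    by rewrite -UE; apply: borel_open; apply: bigcup_open => i _; exact: oU.
  by move=> i _; rewrite mass_act //; apply: borel_open; exact: oU.
rewrite -mass_bigcup ?enum_uniq //.
- rewrite -UE; apply: mass_le.
  + by apply: borel_open; apply: bigcup_open => i _; apply: open_act; exact: oU.
  + exact: borel_open.
  + by move=> x [i _ /UB].
- by move=> i _; apply: borel_open; apply: open_act; exact: oU.
- by move=> i j _ _; exact: dU.
Qed.

Lemma exists_invariant : has_comparison R a ->
  exists mu : borel_probability R X, invariant_measures a mu.
Proof.
move=> cmp; apply: contrapT => nmu.
have [] := cmp setT set0 closedT open0.
  by move=> mu mu_inv; case: nmu; exists mu.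
move=> n [U [s [_ /(_ point I) [i _ Ui] _ /(_ i)]]].
by apply; exists point.
Qed.

(** The number of [s] in [S] with [a s x] in [A] has integral [#|S| * mu A], so it cannot exceed
    [d * #|S|] at every point. *)
Lemma exists_sparse_point (mu : borel_probability R X) S A (d : R) :
  invariant_measures a mu -> borel A -> mass mu A < d ->
  exists x, #|` [fset s in S | `[< A (a s x) >]]%fset|%:R <= d * #|` S|%:R.
Proof.
move=> mu_inv bA Ad; have [->|S0] := eqVneq S fset0.
  exists point; rewrite cardfs0 mulr0 (_ : [fset _ in _ | _]%fset = fset0).
    by rewrite cardfs0.
  by apply/fsetP => s; rewrite !inE.
apply: contrapT => nx.
have cnt x : d * #|` S|%:R < \sum_(s <- S) \1_(a (s^-1)%g @` A) x.
  rewrite ltNge; apply/negP => le; apply: nx; exists x.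
  apply: le_trans le; rewrite card_fset_sum1 natr_sum -big_fset_condE big_mkcond /=.
  apply: ler_sum => s _; rewrite act_imageE invgK indicE.
  by case: asboolP => As; rewrite ?ler01 // mem_set.
have m_ind s : @measurable_fun _ _ (g_sigma_algebraType (@open X)) (\bar R) setT
    (fun x => (\1_(a (s^-1)%g @` A) x)%:E).
  apply/measurable_EFinP; apply: measurable_indic; exact: borel_act.
have int_sum : (\int[mu]_x (\sum_(s <- S) (\1_(a (s^-1)%g @` A) x)%:E) =
    (#|` S|%:R * mass mu A)%:E)%E.
  rewrite ge0_integral_sum //.
  rewrite (eq_bigr (fun=> (mass mu A)%:E)); last first.
    move=> s _; have <- : mu (a (s^-1)%g @` A) = (mass mu A)%:E.
      by rewrite massE ?mass_act //; exact: borel_act.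
    by rewrite integral_indic //; [rewrite setIT|exact: borel_act].
  by rewrite sumEFin big_const_seq count_predT iter_addr_0 mulr_natl.
have : ((d * #|` S|%:R)%:E <=
    \int[mu]_x (\sum_(s <- S) (\1_(a (s^-1)%g @` A) x)%:E))%E.
  rewrite -[leLHS]mule1 -(@probability_setT _ _ _ mu) -integral_cst //.
  apply: ge0_le_integral => //.
  - move=> x _; rewrite lee_fin mulr_ge0 //; apply: le_trans (ltW Ad).
    exact: mass_ge0.
  - exact: emeasurable_sum.
  - by move=> x _; rewrite sumEFin lee_fin ltW.
rewrite int_sum lee_fin mulrC ler_pM2l; first by rewrite leNgt Ad.
by rewrite ltr0n cardfs_gt0.
Qed.

End Dynamics.

(** * Open castles from the Rokhlin property, and their shrinking *)

Section Castles.
Context (R : realType) (G : groupType) (X : ptopologicalType)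
  (a : topAction G X).
Implicit Types (A B O : set X) (F K : {fset G}).

Definition uniformly_le A (e : R) := forall mu : borel_probability R X,
  invariant_measures a mu -> mass mu A <= e.

Lemma Rokhlin_castle K (d : R) : uniform_Rokhlin R a -> 0 < d ->
  exists n (S : 'I_n -> {fset G}) (V : 'I_n -> set X),
    [/\ forall k, S k != fset0 /\ V k !=set0, levels_disjoint a S V,
        forall k, open (V k), forall k, approx_invariant K d (S k) &
        forall mu : borel_probability R X, invariant_measures a mu ->
          mass mu (~` levels a S V) < d].
Proof.
move=> /(_ K d) URP /URP[n [S [V [[cas oV] KS remd]]]].
have {}oV k : open (V k).
  have [tow _] := cas; have [/fset0Pn[s sS] _ _] := tow k.
  by rewrite -[V k](act_image1 a) -(mulVg s) -act_imageM; apply/open_act/oV.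
exists n, S, V; split=> //.
- by move=> k; have [tow _] := cas; have [] := tow k.
- exact: castle_levels_disjoint.
- move=> mu mu_inv; rewrite -lte_fin -massE; last first.
    by apply: borelC; apply: borel_open; exact: open_levels.
  apply: le_lt_trans remd; by apply: ereal_sup_ubound; exists mu.
Qed.

(** The base of a tower with more than [e^-1] levels has mass below [e], because its levels are
    disjoint and of equal mass. *)
Lemma small_open (e : R) : infinite_set [set: G] -> uniform_Rokhlin R a ->
  has_comparison R a -> 0 < e ->
  exists O, [/\ open O, O !=set0 & uniformly_le O e].
Proof.
move=> infG URP cmp e0.
(* A shape nearly invariant under [K] has at least as many elements as [K], hence more than
   [e^-1]. *)
have [K _ cK] := @infinite_set_fset _ [set: G] (Num.bound e^-1) infG.
have [|n [S [V [nz sep oV KS rem]]]] := @Rokhlin_castle K 2^-1 URP; first by lra.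
have [mu0 mu0_inv] := exists_invariant cmp.
have mS (mu : borel_probability R X) (mu_inv : invariant_measures a mu) :
    mass mu (levels a S V) = \sum_k #|` S k|%:R * mass mu (V k).
  apply: (mass_levels mu_inv sep) => k; first exact: fsubset_refl.
    exact: subset_refl.
  by apply: borel_open; exact: oV.
(* Without towers the remainder would be the whole space, of mass 1, against the bound 1/2. *)
have [k0 _|n0] := pickP 'I_n; last first.
  have := rem _ mu0_inv; rewrite mass_setC ?mS // ?big_pred0 //; first by lra.
  by apply: borel_open; exact: open_levels.
exists (V k0); split => //; first by case: (nz k0).
move=> mu mu_inv; have := mS mu mu_inv; rewrite (bigD1 k0) //= => eS.
have : mass mu (levels a S V) <= 1.
  rewrite -[leRHS](mass_setT mu); apply: mass_le => //.
    by apply: borel_open; exact: open_levels.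
  exact: borel_open openT.
have : 0 <= \sum_(i < n | i != k0) #|` S i|%:R * mass mu (V i).
  by apply: sumr_ge0 => i _; rewrite mulr_ge0 // mass_ge0.
rewrite eS => ge0 le1.
have {ge0}le1 : #|` S k0|%:R * mass mu (V k0) <= 1 by lra.
have cS : e^-1 < #|` S k0|%:R.
  apply: lt_le_trans (archi_boundP _) _; first by rewrite invr_ge0 ltW.
  rewrite ler_nat; apply: leq_trans cK _.
  by apply: (leq_card_invariant _ (nz k0).1 (KS k0)); lra.
have S0 : 0 < #|` S k0|%:R :> R by apply: lt_trans cS; rewrite invr_gt0.
rewrite -(ler_pM2l S0); apply: le_trans le1 _.
by rewrite -ler_pdivrMr // mul1r ltW.
Qed.

(** The closed remainder has an open neighbourhood [W] of mass at most [e]. The part of the castle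
    outside [W] sits over closed subsets of the bases, which leaves room for two nested shrinkings
    that still cover this part. *)
Lemma shrunk_castle K (e : R) : compact [set: X] -> hausdorff_space X ->
  infinite_set [set: G] -> minimal_action a -> uniform_Rokhlin R a ->
  has_comparison R a -> 0 < e ->
  exists n (S : 'I_n -> {fset G}) (V B Z : 'I_n -> set X),
    [/\ forall k, S k != fset0 /\ approx_invariant K e (S k), levels_disjoint a S V,
        forall k, [/\ open (V k), open (B k) & open (Z k)],
        forall k, closure (Z k) `<=` B k /\ closure (B k) `<=` V k &
        uniformly_le (~` levels a S Z) e].
Proof.
move=> cX hX infG minX URP cmp e0.
have [D [oO O0 Oe]] := small_open infG URP cmp e0.
have [F FO] := minimal_cover cX minX oO O0.
have FO1 (mu : borel_probability R X) (mu_inv : invariant_measures a mu) :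
    1 <= #|` F|%:R * mass mu D.
  rewrite -[leLHS](mass_setT mu); apply: (mass_cover mu_inv) => [||x _]; last exact: FO.
    by apply: borel_open; exact: openT.
  exact: borel_open.
have F0 : 0 < #|` F|%:R :> R.
  by rewrite ltr0n cardfs_gt0; apply/fset0Pn; have [f fF _] := FO point; exists f.
(* Every invariant measure gives [D] mass at least [1 / #|F|], so a remainder below this value is
   subequivalent to [D] by comparison. *)
have [|n [S [V [nz sep oV KS rem]]]] :=
    @Rokhlin_castle K (Num.min e #|` F|%:R^-1) URP.
  by rewrite lt_min e0 invr_gt0.
have oP : open (levels a S V) by exact: open_levels.
have [W [oW RW We]] : exists W, [/\ open W, ~` levels a S V `<=` W & uniformly_le W e].
  have [|W [oW RW Wm]] := @subequivalent_nbhd R G X a (~` levels a S V) D oO.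
  - apply: cmp => //; first exact: open_closedC.
    move=> mu mu_inv; rewrite mass_lt //; last exact: borel_open.
      apply: lt_le_trans (rem _ mu_inv) _; rewrite ge_min; apply/orP; right.
      by rewrite -(ler_pM2l F0) divff ?gt_eqF // FO1.
    by apply: borelC; exact: borel_open.
  - exists W; split => // mu mu_inv; apply: le_trans (Wm _ mu_inv) _; exact: Oe.
pose C k := \bigcup_(s in [set` S k]) [set y | V k y /\ ~ W (a s y)].
have CV k : C k `<=` V k by move=> y [s _ []].
have cC k : closed (C k).
  apply: closed_bigcup => // s sS y cy.
  have nW : ~ W (a s y).
    have : closed (a s @^-1` (~` W)).
      by apply: closed_comp => [x _|]; [exact: act_continuous|exact: open_closedC].
    by move=> cW; apply: (closure_min cW _ cy) => z [].
  (* A limit point [y] of such base points has [a s y] outside [W], hence in some level. This level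
     is open, so it meets the level over [k] and [s], and by disjointness equals it; thus [y] lies
     in [V k]. *)
  split => //; have /levelsP[k' [s' [y' [sS' Vy' e']]]] : levels a S V (a s y).
    by apply: contrapT => /RW.
  have [|||z [/= [Vz _] [z' Vz' ez]]] :=
      @closure_meets_open _ [set y | V k y /\ ~ W (a s y)] (a (s^-1 * s')%g @` V k') y.
  - by apply: open_act; exact: oV.
  - by exists y' => //; rewrite actM -e' actVK.
  - exact: cy.
  have [ek es ey] : [/\ k = k', s = s' & z = z'].
    by apply: (sep _ _ _ _ _ _ sS Vz sS' Vz'); rewrite -ez -actM mulgA mulgV mul1g.
  subst k' s'; move/act_inj: e' => ->; exact: Vy'.
have /choice[Z hZ] k := compact_shrink hX cX (cC k) (oV k) (@CV k).
have /choice[B hB] k : exists B, [/\ open B, closure (Z k) `<=` B & closure B `<=` V k].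
  have [oZ CZ ZV] := hZ k.
  by apply: compact_shrink => //; exact: closed_closure.
exists n, S, V, B, Z; split => //.
- move=> k; split; first by case: (nz k).
  apply: le_trans (KS k); rewrite ler_wpM2r // lerD2l lerN2.
  by rewrite ge_min lexx.
- by move=> k; have [] := hZ k; have [] := hB k.
- by move=> k; have [] := hB k.
- move=> mu mu_inv; apply: le_trans (We _ mu_inv); apply: mass_le.
  + by apply: borelC; apply: borel_open; apply: open_levels => k; have [] := hZ k.
  + exact: borel_open.
  + move=> x nx; apply: contrapT => nWx; apply: nx.
    have /levelsP[k [s [y [sS Vy e']]]] : levels a S V x by apply: contrapT => /RW.
    apply/levelsP; exists k, s, y; split => //.
    have [_ CZ _] := hZ k; apply: CZ; exists s => //.
    by split; rewrite // -e'.
Qed.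

End Castles.

(** * Dealing the tiles of a shape into equal classes *)

Section Tilings.
Context (G : groupType).
Implicit Types (E K S : {fset G}).

(** The sets [E (T c)] are pairwise disjoint inside [S], which will give [E]-disjointness of the
    array. By the last clause, the [E]-core of each class still has nearly the fair share
    [#|S| / #|C|]. *)
Definition equitiling (R : realType) (C : finType) E (d : R) S
    (T : C -> {fset G}) : Prop :=
  [/\ forall c c', #|` T c| = #|` T c'|,
      forall c e t, t \in T c -> e \in E -> (e * t)%g \in S,
      forall c c' e e' t t', t \in T c -> t' \in T c' -> e \in E -> e' \in E ->
        (e * t = e' * t')%g -> c = c' &
      forall c, (1 - d) * #|` S|%:R <= #|C|%:R * #|` core E (T c)|%:R].

Lemma tiles_inj_sub (J : finType) (Q Q' Z Z' : J -> {fset G}) :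
  (forall j, Q' j `<=` Q j)%fset -> (forall j, Z' j `<=` Z j)%fset ->
  tiles_inj Q Z -> tiles_inj Q' Z'.
Proof.
move=> sQ sZ inj j t z j' t' z' tQ zZ tQ' zZ'.
by apply: inj; first [exact: (fsubsetP (sQ _)) | exact: (fsubsetP (sZ _))].
Qed.

(** Each [Z j] is dealt equally to the classes, and every tile is trimmed to its [E]-core, so that
    multiplying a class by [E] does not leave its own tiles. *)
Lemma exists_equitiling_of_tiles (R : realType) (C : finType) (J : finType)
    E (d : R) S (Q Z : J -> {fset G}) :
  (0 < #|C|)%N -> 1%g \in E -> d <= 1 -> tiles_inj Q Z -> (tiles Q Z `<=` S)%fset ->
  (forall j, approx_invariant (mulfs E E) d (Q j)) ->
  (1 - 2 * d) * #|` S|%:R <= #|` tiles Q Z|%:R ->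
  #|C|%:R * (\sum_j #|` Q j|%:R) <= d * #|` S|%:R ->
  exists T : C -> {fset G}, equitiling E (4 * d) S T.
Proof.
move=> C0 E1 d1 inj tS QE big small.
have /choice[f hf] j := fset_equipartition C (Z j).
have fZ c j : (f j c `<=` Z j)%fset by have [] := hf j.
have fdisj j c c' x : x \in f j c -> x \in f j c' -> c = c'.
  by have [_ + _] := hf j; apply.
have fcard c j : #|` f j c| = (#|` Z j| %/ #|C|)%N by have [] := hf j.
exists (fun c => tiles (fun j => core E (Q j)) (f ^~ c)).
have tinj E' c : tiles_inj (fun j => core E' (Q j)) (f ^~ c).
  by apply: tiles_inj_sub inj => // j; exact: core_sub.
split.
- move=> c c'; rewrite !card_tiles //; apply: eq_bigr => j _.
  by rewrite !fcard.
- move=> c e ? /tilesP[j [t [z [/coreP[tQ tE] zZ ->]]]] eE.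
  apply: (fsubsetP tS); apply/tilesP; exists j, (e * t)%g, z.
  by split; [exact: tE|exact: (fsubsetP (fZ c j))|rewrite mulgA].
- move=> c c' e e' ? ? /tilesP[j [t [z [/coreP[tQ tE] zZ ->]]]].
  move=> /tilesP[j' [t' [z' [/coreP[tQ' tE'] zZ' ->]]]] eE eE' /eqP.
  rewrite !mulgA => /eqP.
  move/(inj _ _ _ _ _ _ (tE _ eE) (fsubsetP (fZ c j) _ zZ) (tE' _ eE')
    (fsubsetP (fZ c' j') _ zZ')) => [ej _ ez].
  by subst j' z'; exact: fdisj zZ zZ'.
- move=> c.
  (* If [t] is in the core for [E E], then [e t] is in the core for [E]: this is why the tiles are
     assumed nearly invariant under [mulfs E E]. *)
  have sub : (tiles (fun j => core (mulfs E E) (Q j)) (f ^~ c) `<=`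
      core E (tiles (fun j => core E (Q j)) (f ^~ c)))%fset.
    apply/fsubsetP => _ /tilesP[j [t [z [/coreP[tQ tE] zZ ->]]]].
    have tQE e : e \in E -> (e * t)%g \in Q j.
      by move=> eE; rewrite -[e]mulg1; apply: tE; exact: mem_mulfs.
    apply/coreP; split=> [|e eE]; apply/tilesP.
      by exists j, t, z; split => //; apply/coreP.
    exists j, (e * t)%g, z; split; rewrite ?mulgA //; apply/coreP.
    split=> [|e' eE']; first exact: tQE.
    by rewrite mulgA; apply: tE; exact: mem_mulfs.
  apply: (@le_trans _ _ (#|C|%:R *
      #|` tiles (fun j => core (mulfs E E) (Q j)) (f ^~ c)|%:R)); last first.
    by rewrite ler_wpM2l // ler_nat; exact: fsubset_leq_card.
  rewrite card_tiles // natr_sum mulr_sumr.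
  (* Division of [#|Z j|] by [#|C|] wastes at most [#|C|] tiles of type [j]. *)
  apply: (@le_trans _ _ (\sum_j (1 - d) *
      (#|` Q j|%:R * #|` Z j|%:R - #|C|%:R * #|` Q j|%:R))); last first.
    apply: ler_sum => j _; rewrite natrM fcard.
    have := QE j; rewrite /approx_invariant -/(core _ _).
    have : (#|` Z j|%:R : R) <= #|C|%:R * (#|` Z j| %/ #|C|)%:R + #|C|%:R.
      by rewrite -natrM -natrD ler_nat; have := ltn_ceil #|` Z j| C0; lia.
    move: (#|` core _ _|%:R : R) (#|` Z j|%:R : R) (#|C|%:R : R)
      (ler0n R (#|` Z j| %/ #|C|)) (ler0n R #|C|) (ler0n R #|` Q j|).
    move: ((#|` Z j| %/ #|C|)%:R : R) (#|` Q j|%:R : R) => q u w z N q0 N0 u0 zle wle.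
    apply: (@le_trans _ _ (N * q * ((1 - d) * u))); last first.
      by rewrite -mulrA [w * q]mulrC ler_wpM2l // ler_wpM2l.
    rewrite [leRHS]mulrCA ler_wpM2l ?subr_ge0 // [N * q * u]mulrC.
    by rewrite [N * u]mulrC -mulrBr ler_wpM2l // lerBlDr.
  rewrite -mulr_sumr sumrB -mulr_sumr.
  have -> : \sum_j (#|` Q j|%:R * #|` Z j|%:R : R) = #|` tiles Q Z|%:R.
    by rewrite card_tiles // natr_sum; apply: eq_bigr => j _; rewrite natrM.
  (* The loss is [2 d] for the untiled part, [d] for the rounding and a factor [1 - d] for the
     trimming, at most [4 d] in total. *)
  apply: (@le_trans _ _ ((1 - d) * ((1 - 3 * d) * #|` S|%:R))).
    rewrite mulrA ler_wpM2r //; have := sqr_ge0 d; rewrite expr2; nra.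
  by rewrite ler_wpM2l ?subr_ge0 //; lra.
Qed.

End Tilings.

(** * Tiling nearly invariant shapes along an orbit *)

Section Dynamics.
Context (R : realType) (G : groupType) (X : ptopologicalType)
  (a : topAction G X).

Lemma exists_equitiling (C : finType) (E : {fset G}) (d : R) :
  infinite_set [set: G] -> uniform_Rokhlin R a -> has_comparison R a ->
  (0 < #|C|)%N -> 1%g \in E -> 0 < d ->
  exists (K : {fset G}) (d' : R), 0 < d' /\ forall S : {fset G}, S != fset0 ->
    approx_invariant K d' S -> exists T : C -> {fset G}, equitiling E d S T.
Proof.
move=> infG URP cmp C0 E1 d0.
pose d' := Num.min d 1 / 4.
have d'0 : 0 < d' by rewrite divr_gt0 // lt_min d0 ltr01.
have d'1 : d' <= 1 / 4 by rewrite ler_wpM2r ?invr_ge0 // ge_min lexx orbT.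
have d'd : 4 * d' <= d by rewrite mulrC divfK // ge_min lexx.
have [n [Q [Y [nz sep oY QE rem]]]] := @Rokhlin_castle R G X a (mulfs E E) d' URP d'0.
have [mu mu_inv] := exists_invariant cmp.
pose M : R := #|C|%:R * (\sum_j #|` Q j|%:R).
have [K1 _ cK1] := @infinite_set_fset _ [set: G] (Num.bound (M / d')) infG.
pose Qall := (\big[fsetU/fset0]_j Q j)%fset.
have QallP j t : t \in Q j -> t \in Qall.
  by move=> tQ; apply/bigfcupP; exists j; rewrite ?mem_index_enum.
pose invf (A : {fset G}) := [fset (g^-1)%g | g in A]%fset.
have mem_invf (A : {fset G}) g : g \in A -> (g^-1)%g \in invf A.
  by move=> gA; exact: in_imfset.
(* Invariance under [Q Q^-1] keeps the whole tile around a core element inside [S]; [K1] makes [S]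
   so large that rounding costs at most [d' * #|S|]. *)
exists (mulfs Qall (invf Qall) `|` K1)%fset, d'; split => // S S0 SK.
have M0 : 0 <= M by rewrite mulr_ge0 // sumr_ge0.
have SM : M <= d' * #|` S|%:R.
  rewrite mulrC -ler_pdivrMr //; apply: le_trans (ltW (archi_boundP _)) _.
    by rewrite divr_ge0 // ltW.
  rewrite ler_nat; apply: leq_trans cK1 _.
  apply: leq_trans (leq_card_invariant _ S0 SK); last by lra.
  by apply: fsubset_leq_card; exact: fsubsetUr.
have [||x xrem] := @exists_sparse_point R G X a mu S (~` levels a Q Y) d' mu_inv.
- by apply: borelC; apply: borel_open; exact: open_levels.
- exact: rem.
(* The times at which the orbit of [x] visits the base [Y j], kept when the full tile fits in [S];
   the ambient product set only serves to make this finite. *)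
pose Z j := [fset g in mulfs (invf (Q j)) S |
  `[< Y j (a g x) >] && all (fun t => (t * g)%g \in S) (Q j)]%fset.
have ZP j g : g \in Z j -> Y j (a g x) /\ forall t, t \in Q j -> (t * g)%g \in S.
  by rewrite !inE => /and3P[_ /asboolP Yg /allP].
have inj : tiles_inj Q Z.
  move=> j t z j' t' z' tQ /ZP[Yz _] tQ' /ZP[Yz' _] e.
  have [] := sep _ _ _ _ _ _ tQ Yz tQ' Yz'; first by rewrite -!actM e.
  by move=> -> et _; split => //; move: e; rewrite et; exact: mulgI.
have tS : (tiles Q Z `<=` S)%fset.
  by apply/fsubsetP => _ /tilesP[j [t [z [tQ /ZP[_ zS] ->]]]]; exact: zS.
(* If [s x] lies in level [t] over [Y j], then [s] belongs to the tile of the visit time [t^-1 s];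
   the exceptional [s] are few by the choice of [x]. *)
have cov : (core (mulfs Qall (invf Qall) `|` K1) S `<=`
    tiles Q Z `|` [fset s in S | `[< (~` levels a Q Y) (a s x) >]])%fset.
  apply/fsubsetP => s /coreP[sS Ks]; rewrite inE; apply/orP.
  have [|nx] := pselect (levels a Q Y (a s x)); last first.
    by right; rewrite !inE sS /=; apply/asboolP.
  move/levelsP => [j [t [y [tQ Yy e]]]]; left; apply/tilesP.
  exists j, t, (t^-1 * s)%g; split; rewrite ?mulVKg //.
  rewrite !inE; apply/and3P; split.
  - by apply: mem_mulfs => //; exact: mem_invf.
  - by apply/asboolP; rewrite actM e actVK.
  - apply/allP => t' tQ'; rewrite mulgA; apply: Ks; rewrite inE.
    apply/orP; left; apply: mem_mulfs; [exact: QallP tQ'|].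
    by apply: mem_invf; exact: QallP tQ.
have [||T eqT] := @exists_equitiling_of_tiles G R C _ E d' S Q Z C0 E1 _ inj tS QE _ SM.
- by lra.
- have := fsubset_leq_card cov; rewrite -(ler_nat R) => le.
  have := leq_card_fsetU (tiles Q Z)
    [fset s in S | `[< (~` levels a Q Y) (a s x) >]]%fset.
  move=> [+ _]; rewrite -(ler_nat R) natrD.
  move: SK; rewrite /approx_invariant -/(core _ _); lra.
exists T; case: eqT => ? ? ? h; split => // c.
by apply: le_trans (h c); rewrite ler_wpM2r // lerD2l lerN2.
Qed.

End Dynamics.

(** * Equivalence, disjointness and mass of the classes of a castle *)

Lemma closure_bigcup_fin (X : topologicalType) (I : finType) (A : I -> set X) :
  closure (\bigcup_i A i) `<=` \bigcup_i closure (A i).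
Proof.
apply: closure_min.
  by apply: closed_bigcup => [|i _]; [exact: finite_finset|exact: closed_closure].
by move=> x [i _ Ax]; exists i => //; exact: subset_closure.
Qed.

(** Symmetric form, with no distinguished index: the normalisation at [i0] is recovered by moving
    each piece by [s j i0] and multiplying [s j i] on the right by its inverse. *)
Lemma pairwise_equivalent_fin (G : groupType) (X : topologicalType)
    (a : topAction G X) (I J : finType) (i0 : I) (V : I -> set X)
    (C : J -> set X) (s : J -> I -> G) :
  (forall j, open (C j)) -> (forall i, V i = \bigcup_j (a (s j i) @` C j)) ->
  trivIset [set: J * I] (fun p => closure (a (s p.1 p.2) @` C p.1)) ->
  pairwise_equivalent a i0 V.
Proof.
move=> oC VE dis.
pose e (k : 'I_#|J|) := enum_val k.
have sC k i : a (s (e k) i * (s (e k) i0)^-1)%g @` (a (s (e k) i0) @` C (e k)) =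
    a (s (e k) i) @` C (e k).
  by rewrite act_imageM mulgVK.
have VEe i : V i = \bigcup_k (a (s (e k) i) @` C (e k)).
  rewrite VE; apply/seteqP; split=> x [j _ Cx].
    by exists (enum_rank j) => //; rewrite /e enum_rankK.
  by exists (e j).
exists #|J|, (fun k => a (s (e k) i0) @` C (e k)),
  (fun k i => (s (e k) i * (s (e k) i0)^-1)%g); split.
- by move=> k; apply: sub_sigma_algebra; exact: open_act.
- exact: VEe.
- by move=> k; rewrite mulgV.
- by move=> i; rewrite VEe; apply: eq_bigcupr => k _; rewrite sC.
- move=> [k i] [k' i'] _ _ /=; rewrite !sC => ne.
  have [/enum_val_inj -> ->] // : (e k, i) = (e k', i') by exact: dis.
Qed.

Section Arrays.
Context (R : realType) (G : groupType) (X : ptopologicalType)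
  (a : topAction G X).
Context (C : finType) (m : nat) (S : 'I_m -> {fset G}) (V B Z : 'I_m -> set X)
  (E : {fset G}) (d : R) (T : 'I_m -> C -> {fset G}).
Context (sep : levels_disjoint a S V) (oV : forall k, open (V k))
  (oB : forall k, open (B k)) (oZ : forall k, open (Z k))
  (ZB : forall k, closure (Z k) `<=` B k) (BV : forall k, closure (B k) `<=` V k).
Context (E1 : 1%g \in E) (eqT : forall k, equitiling E d (S k) (T k)).

Let ZB' k : Z k `<=` B k.
Proof. exact: subset_trans (@subset_closure _ _) (@ZB k). Qed.

Let BV' k : B k `<=` V k.
Proof. exact: subset_trans (@subset_closure _ _) (@BV k). Qed.

Let ZV k : Z k `<=` V k.
Proof. exact: subset_trans (@ZB' k) (@BV' k). Qed.

Lemma class_sub k c : (T k c `<=` S k)%fset.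
Proof.
apply/fsubsetP => t tT; have [_ + _ _] := eqT k.
by move=> /(_ c 1%g t tT E1); rewrite mul1g.
Qed.

Lemma class_disjoint k c c' t : t \in T k c -> t \in T k c' -> c = c'.
Proof.
by move=> tT tT'; have [_ _ /(_ c c' 1%g 1%g t t tT tT' E1 E1 erefl)] := eqT k.
Qed.

Lemma levels_class_inj c c' x :
  levels a (T ^~ c) V x -> levels a (T ^~ c') V x -> c = c'.
Proof.
case/levelsP => k [t [y [tT Vy ->]]] /levelsP[k' [t' [y' [tT' Vy' e]]]].
have [ek et _] := sep (fsubsetP (class_sub k c) _ tT) Vy
  (fsubsetP (class_sub k' c') _ tT') Vy' e.
by subst k' t'; exact: class_disjoint tT tT'.
Qed.

(** Within one tower all classes have the same number of levels, so they are matched by position in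
    their enumerations. The closures are disjoint because [closure (B k)] lies in [V k]. *)
Lemma levels_class_equivalent (I : finType) (i0 : I) (u : I -> C) : injective u ->
  pairwise_equivalent a i0 (fun i => levels a (T ^~ (u i)) B).
Proof.
move=> u_inj; pose J := {k : 'I_m & 'I_#|` T k (u i0)|}.
have szT k i : size (T k (u i)) = #|` T k (u i0)| by have [+ _ _ _] := eqT k; apply.
(* The default [1] is never reached, since the classes of a tower have equal cardinality. *)
pose s (j : J) i := nth 1%g (T (tag j) (u i)) (tagged j).
have sT (j : J) i : s j i \in T (tag j) (u i).
  by rewrite mem_nth // szT.
apply: (@pairwise_equivalent_fin _ _ a I J i0 _ (fun j => B (tag j)) s).
- by move=> j; exact: oB.
- move=> i; apply/seteqP; split=> x.
    move/levelsP => [k [t [y [tT By ->]]]].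
    have lt : (index t (T k (u i)) < #|` T k (u i0)|)%N by rewrite -(szT k i) index_mem.
    exists (Tagged (fun k => 'I_#|` T k (u i0)|) (Ordinal lt) : J) => //=.
    by rewrite /s /= nth_index //; exists y.
  move=> [j _ [y By <-]]; apply/levelsP; exists (tag j), (s j i), y.
  by split=> //; exact: sT.
- move=> [j i] [j' i'] _ _ [x []] /=.
  move=> /subset_closure_act [y /BV Vy <-] /subset_closure_act [y' /BV Vy' e].
  have [ek es _] := sep (fsubsetP (class_sub _ _) _ (sT j' i')) Vy'
    (fsubsetP (class_sub _ _) _ (sT j i)) Vy e.
  case: j j' Vy Vy' e ek es => [k l] [k' l'] /= Vy Vy' e ek; subst k' => es.
  have ei : i = i'.
    apply: u_inj; apply: class_disjoint (sT (existT _ k l) i) _.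
    by rewrite -es; exact: (sT (existT _ k l') i').
  subst i'; congr (_, _); congr existT; apply/ord_inj/eqP; rewrite eq_sym.
  have lt (j : 'I_#|` T k (u i0)|) : (j < size (T k (u i)))%N.
    by rewrite szT; exact: ltn_ord.
  by move/eqP: es; rewrite /s /= nth_uniq ?fset_uniq ?lt.
Qed.

Lemma levels_class_disjoint (E' : {fset G}) (I : Type) (u : I -> C) :
  injective u -> (E' `<=` E)%fset ->
  pairwise_disjoint_wrt a E' (fun i => levels a (T ^~ (u i)) B).
Proof.
move=> u_inj sE i i' _ _ [x [[e eE [y cy <-]] [e' eE' [y' cy' eq]]]].
have eEE : e \in E by exact: (fsubsetP sE).
have eEE' : e' \in E by exact: (fsubsetP sE).
case/closure_levels/levelsP: cy eq => k [t [z [tT /BV Vz ->]]].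
case/closure_levels/levelsP: cy' => k' [t' [z' [tT' /BV Vz' ->]]].
rewrite -!actM => eq; apply: u_inj.
have [_ sS _ _] := eqT k; have [_ sS' _ _] := eqT k'.
have [ek et _] := sep (sS' _ _ _ tT' eEE') Vz' (sS _ _ _ tT eEE) Vz eq.
subst k'; have [_ _ + _] := eqT k.
by move=> /(_ _ _ _ _ _ _ tT tT' eEE eEE'); apply.
Qed.

Section Mass.
Context (mu : borel_probability R X) (mu_inv : invariant_measures a mu).

(** The classes are disjoint and have equal mass, as they take equally many levels from each
    tower. *)
Lemma mass_class_le c : #|C|%:R * mass mu (levels a (T ^~ c) V) <= 1.
Proof.
have mE c' : mass mu (levels a (T ^~ c') V) = \sum_k #|` T k c'|%:R * mass mu (V k).
  apply: (mass_levels mu_inv sep) => k; first exact: class_sub.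
    exact: subset_refl.
  exact: borel_open.
have bP c' : borel (levels a (T ^~ c') V).
  by apply: borel_open; apply: open_levels.
rewrite -[leRHS](mass_setT mu).
have -> : #|C|%:R * mass mu (levels a (T ^~ c) V) =
    mass mu (\bigcup_(c' in [set` enum C]) levels a (T ^~ c') V).
  rewrite mass_bigcup ?enum_uniq //.
    rewrite big_enum /= (eq_bigr (fun=> mass mu (levels a (T ^~ c) V))).
      by rewrite sumr_const mulr_natl.
    move=> c' _; rewrite !mE; apply: eq_bigr => k _.
    by have [/(_ c' c) -> _ _ _] := eqT k.
  by move=> c1 c2 _ _ [x [/levels_class_inj h /h]].
apply: mass_le => //; last by apply: borel_open; exact: openT.
by apply: borel_bigcup => // c' _.
Qed.

Lemma mass_core_ge c (e : R) : 0 <= d <= 1 -> mass mu (~` levels a S Z) <= e ->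
  (1 - d) * (1 - e) <= #|C|%:R * mass mu (levels a (fun k => core E (T k c)) Z).
Proof.
move=> /andP[d0 d1]; rewrite mass_setC; last first.
  by apply: borel_levels => k; exact: borel_open.
have bZ k : borel (Z k) by exact: borel_open.
rewrite (mass_levels mu_inv sep _ ZV bZ); last by move=> k; exact: fsubset_refl.
rewrite (mass_levels mu_inv sep _ ZV bZ); last first.
  by move=> k; apply: fsubset_trans (class_sub k c); exact: core_sub.
rewrite mulr_sumr => le.
apply: (@le_trans _ _ (\sum_k (1 - d) * (#|` S k|%:R * mass mu (Z k)))).
  by rewrite -mulr_sumr ler_wpM2l ?subr_ge0 //; lra.
apply: ler_sum => k _; rewrite !mulrA ler_wpM2r ?mass_ge0 //.
by have [_ _ _] := eqT k; apply.
Qed.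

End Mass.
End Arrays.

Lemma mass_bigcup_ge (R : realType) (X : ptopologicalType)
    (mu : borel_probability R X) (C : choiceType) (r : seq C) (A : C -> set X) (w : R) :
  uniq r -> (forall c, borel (A c)) -> trivIset setT A ->
  (forall c, w <= mass mu (A c)) ->
  (size r)%:R * w <= mass mu (\bigcup_(c in [set` r]) A c).
Proof.
move=> ur bA tA wA; rewrite mass_bigcup //; last exact: sub_trivIset tA.
rewrite mulr_natl -(iter_addr_0 (size r) w) -count_predT -big_const_seq.
by apply: ler_sum => c _.
Qed.

(** * The array and its three subequivalences *)

Section Main.
Context (R : realType) (G : groupType) (X : ptopologicalType)
  (a : topAction G X).
Context (G_infinite : infinite_set [set: G]) (X_compact : compact [set: X])
  (X_hausdorff : hausdorff_space X) (a_minimal : minimal_action a)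
  (a_URP : uniform_Rokhlin R a) (a_comparison : has_comparison R a).

Lemma inter_translatesP (V : set X) (E : {fset G}) x :
  inter_translates a V E x <-> forall e, e \in E -> V (a e x).
Proof.
split=> [Vx e eE|Vx e eE].
  by have := Vx e eE; rewrite act_imageE invgK.
by rewrite act_imageE invgK; exact: Vx.
Qed.

Lemma open_inter_translates (V : set X) (E : {fset G}) :
  open V -> open (inter_translates a V E).
Proof.
move=> oV; rewrite -closedC setC_bigcap; apply: closed_bigcup => // e eE.
by apply: open_closedC; exact: open_act.
Qed.

Section Array.
Context (q : nat) (F E : {fset G}) (O1 O2 : set X).
Context (q0 : (0 < q)%N) (qF : (#|` F| <= q)%N) (E1 : 1%g \in E)
  (oO1 : open O1) (oO2 : open O2).
Context (FO1 : forall x, exists2 f, f \in F & O1 (a f x))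
  (FO2 : forall x, exists2 f, f \in F & O2 (a f x)).

(** The array has [n.+1] columns. The [n] cells of a row outside column [ord0] together carry about
    [n / (q N) > 2 / N] of [O1] or [O2], well above the mass [1 / N] that one class can have. *)
Let n := (2 * q).+1.
Let I := 'I_n.+1.
(* [None] is the class of tiles kept outside the array. *)
Let C : finType := option (I * I)%type.
Let N : R := #|C|%:R.
(** The total error [eta] is a quarter of [1 / (q N)], which up to a factor [1 - eta] is the share
    of [O1] or [O2] found in one class. *)
Let eta : R := (4 * q%:R * N)^-1.
(** [F] moves a point of a class into [O1] or [O2] without leaving the class; [mulfs E F] ensures
    that it also lands in the [E]-core. *)
Let E' : {fset G} := (E `|` F `|` mulfs E F)%fset.

Context (m : nat) (S : 'I_m -> {fset G}) (V B Z : 'I_m -> set X)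
  (T : 'I_m -> C -> {fset G}).
Context (sep : levels_disjoint a S V) (oV : forall k, open (V k))
  (oB : forall k, open (B k)) (oZ : forall k, open (Z k))
  (ZB : forall k, closure (Z k) `<=` B k) (BV : forall k, closure (B k) `<=` V k).
Context (eqT : forall k, equitiling E' (eta / 2) (S k) (T k)).
Context (remZ : forall mu : borel_probability R X, invariant_measures a mu ->
  mass mu (~` levels a S Z) <= eta / 2).

Let ZB' k : Z k `<=` B k.
Proof. exact: subset_trans (@subset_closure _ _) (@ZB k). Qed.

Let BV' k : B k `<=` V k.
Proof. exact: subset_trans (@subset_closure _ _) (@BV k). Qed.

Let ZV k : Z k `<=` V k.
Proof. exact: subset_trans (@ZB' k) (@BV' k). Qed.

Let EE' : (E `<=` E')%fset.
Proof. by rewrite /E' -fsetUA fsubsetUl. Qed.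

Let E'1 : 1%g \in E'.
Proof. exact: (fsubsetP EE'). Qed.

Let TS k c : (T k c `<=` S k)%fset := class_sub E'1 eqT k c.

(** The good part of class [c]: its [E]-translates stay in the class, over the smallest bases. The
    still smaller [HH c] remains in [D c] after a move by [F]. *)
Let D c := levels a (fun k => core E (T k c)) Z.
Let HH c := levels a (fun k => core E' (T k c)) Z.

Let q_ge1 : 1 <= q%:R :> R.
Proof. by rewrite ler1n. Qed.

Let N_ge1 : 1 <= N.
Proof. by rewrite ler1n card_option. Qed.

Let etaP : 4 * q%:R * N * eta = 1.
Proof.
rewrite divff // !mulf_neq0 //; apply: lt0r_neq0; first exact: lt_le_trans q_ge1.
exact: lt_le_trans N_ge1.
Qed.

Let eta_gt0 : 0 < eta.
Proof.
by rewrite invr_gt0 !mulr_gt0 // ?(lt_le_trans _ q_ge1) ?(lt_le_trans _ N_ge1).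
Qed.

Let eta_le : eta <= 1 / 4.
Proof.
have : 0 <= (q%:R * N - 1) * eta.
  by rewrite mulr_ge0 ?subr_ge0 ?mulr_ege1 // ltW.
have := etaP; nra.
Qed.

Let oD c : open (D c).
Proof. exact: open_levels. Qed.

Let D_class c : D c `<=` levels a (T ^~ c) Z.
Proof. by apply: levels_subl => k; exact: core_sub. Qed.

Let Z_class c : levels a (T ^~ c) Z `<=` levels a (T ^~ c) B.
Proof. exact: levels_subr. Qed.

Let B_class c : levels a (T ^~ c) B `<=` levels a (T ^~ c) V.
Proof. exact: levels_subr. Qed.

Let D_castle c : D c `<=` levels a S Z.
Proof. by move=> x /D_class; apply: levels_subl => k; exact: TS. Qed.

Let class_inj c c' x : levels a (T ^~ c) V x -> levels a (T ^~ c') V x -> c = c'.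
Proof. by move=> h h'; exact: (levels_class_inj sep E'1 eqT h h'). Qed.

Let D_triv (A : set X) : trivIset setT (fun c => A `&` D c).
Proof.
move=> c c' _ _ [x [[_ /D_class/Z_class/B_class h] [_ /D_class/Z_class/B_class]]].
exact: class_inj.
Qed.

Let HD c : HH c `<=` D c.
Proof.
apply: levels_subl => k; apply/fsubsetP => t /coreP[tT tE].
by apply/coreP; split => // e eE; apply: tE; exact: (fsubsetP EE').
Qed.

Section MassD.
Context (mu : borel_probability R X) (mu_inv : invariant_measures a mu).

Let mass_HH c : 1 - eta <= N * mass mu (HH c).
Proof.
have := @mass_core_ge _ _ _ a C m S V B Z E' (eta / 2) T sep oZ ZB BV E'1 eqT
  mu mu_inv c (eta / 2).
have e0 := eta_gt0; have e4 := eta_le.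
have -> : 0 <= eta / 2 <= 1 by lra.
by move=> /(_ isT (remZ mu_inv)); apply: le_trans; nra.
Qed.

Let bHH c : borel (HH c).
Proof. by apply: borel_open; exact: open_levels. Qed.

Lemma mass_core c : (1 - eta) / N <= mass mu (setT `&` D c).
Proof.
rewrite setTI ler_pdivrMr ?(lt_le_trans _ N_ge1) // mulrC.
apply: le_trans (mass_HH c) _; rewrite ler_wpM2l //.
by apply: mass_le => //; exact: borel_open.
Qed.

(** From every point of [HH c] some [f] in [F] leads into both [O] and [D c], so at most [q]
    translates of their intersection cover [HH c]. *)
Lemma mass_core_cover (O : set X) c : open O ->
  (forall x, exists2 f, f \in F & O (a f x)) ->
  (1 - eta) / (q%:R * N) <= mass mu (O `&` D c).
Proof.
move=> oO FO.
have NG : 0 < N by exact: lt_le_trans N_ge1.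
have qG : 0 < q%:R :> R by exact: lt_le_trans q_ge1.
rewrite ler_pdivrMr ?mulr_gt0 // mulrC [_ * N]mulrC -mulrA.
apply: le_trans (mass_HH c) _; rewrite ler_wpM2l //.
apply: (@le_trans _ _ (#|` F|%:R * mass mu (O `&` D c))); last first.
  by rewrite ler_wpM2r ?mass_ge0 // ler_nat.
apply: (mass_cover mu_inv) => //; first by apply: borel_open; exact: openI.
move=> _ /levelsP[k [t [y [/coreP[tT tE] Zy ->]]]].
have [f fF Of] := FO (a t y); exists f => //; split => //.
rewrite -actM; apply/levelsP; exists k, (f * t)%g, y; split => //.
apply/coreP; split=> [|e eE].
  by apply: tE; rewrite /E' !inE fF orbT.
by rewrite mulgA; apply: tE; rewrite /E' in_fsetU mem_mulfs ?orbT.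
Qed.

End MassD.

(** The middle bases are used: closures of cells stay in the disjoint levels over [V], while the
    levels over [closure Z] stay inside the cells. *)
Let V_ (i j : I) := levels a (T ^~ (Some (i, j))) B.
Let VV := \bigcup_(p : I * I) V_ p.1 p.2.
Let U := ~` closure (levels a S Z).
(** [Rm] and [Bd] are the sets [R] and [B] of the definition of square divisibility. *)
Let Rm := ~` VV.
Let Bd := closure VV `&` ~` inter_translates a (VV `&` ~` closure U) E.

Let oV_ i j : open (V_ i j).
Proof. exact: open_levels. Qed.

Let oVV : open VV.
Proof. by apply: bigcup_open. Qed.

Let oU : open U.
Proof. by apply: closed_openC; exact: closed_closure. Qed.

Let closed_Bd : closed Bd.
Proof.
apply: closedI; first exact: closed_closure.
apply: open_closedC; apply: open_inter_translates; apply: openI => //.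
by apply: closed_openC; exact: closed_closure.
Qed.

Let closure_U : closure U `<=` ~` levels a S Z.
Proof.
apply: closure_min; first by apply: open_closedC; exact: open_levels.
exact/subsetC/subset_closure.
Qed.

Let closure_VV x : closure VV x -> exists p k t y,
  [/\ t \in T k (Some p), closure (B k) y & x = a t y].
Proof.
move=> /closure_bigcup_fin [p _ /closure_levels/levelsP[k [t [y h]]]].
by exists p, k, t, y; case: p h.
Qed.

Let D_VV c x : D c x -> closure VV x -> c != None.
Proof.
move=> /D_class/Z_class/B_class cx /closure_VV[p [k [t [y [tT By e]]]]].
suff -> : c = Some p by [].
by apply: class_inj cx _; apply/levelsP; exists k, t, y; split => //; exact: BV.
Qed.

Let D_V p : D (Some p) `<=` V_ p.1 p.2.
Proof. by move=> x /D_class/Z_class; case: p. Qed.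

(** The class [None] stays away from the closure of the array. In a cell, the [E]-translates of a
    point of [D c] lie over [Z], hence in the array and off the closure of [U]. *)
Let Bd_D c : Bd `&` D c = set0.
Proof.
apply/seteqP; split=> // x [[cVx nI] Dx].
have : c != None by exact: D_VV Dx cVx.
case: c Dx => // p Dx _; apply: nI; apply/inter_translatesP => e eE.
have /levelsP[k [t [y [/coreP[tT tE] Zy ex]]]] := Dx.
have pT : levels a (T ^~ (Some p)) Z (a e x).
  by apply/levelsP; exists k, (e * t)%g, y; split; [exact: tE| |rewrite ex actM].
split; first by exists p => //; move: pT; case: (p) => i j /Z_class.
by move=> /closure_U; apply; move: pT; apply: levels_subl => k'; exact: TS.
Qed.

(** A point of [closure VV] that is also in the closure of the levels over [Z] has its base point in
    [closure Z], hence in [B], and so is interior to the array. *)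
Let boundary_U : boundary VV `<=` U.
Proof.
move=> x [cVx nV] cZ; apply: nV; rewrite (interior_id _).1 //.
have [p [k [t [y [tT By e]]]]] := closure_VV cVx.
have /closure_levels/levelsP[k' [t' [y' [tS' Zy' e']]]] := cZ.
have [ek et ey] := sep (fsubsetP (TS k (Some p)) _ tT) (BV By) tS'
  (BV' (ZB Zy')) (etrans (esym e) e').
subst k' t' y'; exists p => //; apply/levelsP; exists k, t, y.
by case: p tT => i j tT; split => //; exact: ZB.
Qed.

Let rowj (i : I) := [seq Some (i, j) : C | j <- enum I & j != ord0].

Let uniq_row i : uniq (rowj i).
Proof.
rewrite map_inj_uniq ?filter_uniq ?enum_uniq -?enumT ?enum_uniq //.
by move=> j j' [].
Qed.

Let size_row i : size (rowj i) = n.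
Proof.
rewrite size_map size_filter -sum1_count big_enum_cond /=.
rewrite sum1_card (eq_card (B := predC1 ord0)) //.
by rewrite cardC1 card_ord.
Qed.

Let row_mass (mu : borel_probability R X) (mu_inv : invariant_measures a mu)
    (O : set X) i :
  open O -> (forall x, exists2 f, f \in F & O (a f x)) ->
  n%:R * ((1 - eta) / (q%:R * N)) <=
    mass mu (\bigcup_(c in [set` rowj i]) (O `&` D c)).
Proof.
move=> oO FO; rewrite -(size_row i); apply: mass_bigcup_ge => //.
- by move=> c; apply: borel_open; exact: openI.
- by move=> c; exact: mass_core_cover.
Qed.

Let row_sub O i : \bigcup_(c in [set` rowj i]) (O `&` D c) `<=`
  O `&` \bigcup_(j in [set j | j != ord0]) V_ i j `&` ~` Bd.
Proof.
move=> x [_ /mapP[j + ->] [Ox Dx]]; rewrite mem_filter => /andP[j0 _].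
split; first by split => //; exists j => //; exact: D_V Dx.
by move=> Bx; have : set0 x by rewrite -(Bd_D (Some (i, j))).
Qed.

Let n_q : n%:R = 2 * q%:R + 1 :> R.
Proof. by rewrite /n -natr1 natrM. Qed.

Let N_gt0 : 0 < N.
Proof. exact: lt_le_trans N_ge1. Qed.

Let q_gt0 : 0 < q%:R :> R.
Proof. exact: lt_le_trans q_ge1. Qed.

(** In units of [1 / N], the right side is the room in one row. The left side bounds both the first
    cell of a row, by 1, and the complement of the array, which is the class [None] up to an error
    [eta]. *)
Let gap : 1 + N * eta < N * (n%:R * ((1 - eta) / (q%:R * N))).
Proof.
have -> : N * (n%:R * ((1 - eta) / (q%:R * N))) = n%:R * (1 - eta) / q%:R.
  by field; rewrite !gt_eqF.
rewrite ltr_pdivlMr // n_q.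
have := etaP; have := eta_le; have := eta_gt0; have := q_ge1; nra.
Qed.

Lemma array_row i : subequivalent a (closure (V_ i ord0))
  (O1 `&` \bigcup_(j in [set j | j != ord0]) V_ i j `&` ~` Bd).
Proof.
have oT : open (O1 `&` \bigcup_(j in [set j | j != ord0]) V_ i j `&` ~` Bd).
  apply: openI; last exact: closed_openC.
  by apply: openI => //; exact: bigcup_open.
apply: a_comparison => //; first exact: closed_closure.
move=> mu mu_inv; rewrite mass_lt; last 2 first.
- by apply: borel_closed; exact: closed_closure.
- exact: borel_open.
have le1 : N * mass mu (closure (V_ i ord0)) <= 1.
  apply: le_trans (mass_class_le sep oV E'1 eqT mu_inv (Some (i, ord0))).
  rewrite ler_wpM2l //; apply: mass_le.
  - by apply: borel_closed; exact: closed_closure.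
  - by apply: borel_open; exact: open_levels.
  - by apply: subset_trans (@closure_levels _ _ _ _ _ _) _; exact: levels_subr.
have ge1 : n%:R * ((1 - eta) / (q%:R * N)) <=
    mass mu (O1 `&` \bigcup_(j in [set j | j != ord0]) V_ i j `&` ~` Bd).
  apply: le_trans (row_mass mu_inv i oO1 FO1) _; apply: mass_le.
  - by apply: borel_bigcup => // c _; apply: borel_open; exact: openI.
  - exact: borel_open.
  - exact: row_sub.
apply: lt_le_trans ge1; rewrite -(ltr_pM2l N_gt0).
apply: le_lt_trans le1 (le_lt_trans _ gap).
by rewrite lerDl mulr_ge0 // ltW.
Qed.

Let V1 := \bigcup_i V_ i ord0.

Let V_V1 i j : j != ord0 -> V_ i j `<=` ~` V1.
Proof.
move=> j0 x /B_class Vx [i' _ /B_class Vx'].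
by have [_ ej] := class_inj Vx Vx'; rewrite ej eqxx in j0.
Qed.

Lemma array_remainder : subequivalent a Rm (O2 `&` VV `&` ~` (V1 `|` Bd)).
Proof.
have -> : O2 `&` VV `&` ~` (V1 `|` Bd) =
    O2 `&` (\bigcup_(p in [set p : I * I | p.2 != ord0]) V_ p.1 p.2) `&` ~` Bd.
  apply/seteqP; split=> x [[Ox]].
    move=> [[i j] _ /= Vx] nVB; split; last by move=> Bx; apply: nVB; right.
    split => //; exists (i, j) => //=; apply/eqP => j0; apply: nVB; left.
    by exists i => //; rewrite -j0.
  move=> [[i j] /= j0 Vx] nB; split; first by split => //; exists (i, j).
  by case=> // V1x; exact: (V_V1 j0 Vx).
have oT : open (O2 `&` (\bigcup_(p in [set p : I * I | p.2 != ord0]) V_ p.1 p.2)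
    `&` ~` Bd).
  apply: openI; last exact: closed_openC.
  by apply: openI => //; apply: bigcup_open.
apply: a_comparison => //; first exact: open_closedC.
move=> mu mu_inv; rewrite mass_lt; last 2 first.
- by apply: borelC; exact: borel_open.
- exact: borel_open.
rewrite mass_setC; last exact: borel_open.
pose r : seq C := [seq Some p | p <- enum {: I * I}].
have ur : uniq r by rewrite map_inj_uniq ?enum_uniq // => p p' [].
have sr : (size r)%:R = N - 1 :> R.
  by rewrite size_map -cardE /N card_option -[#|_|.+1%:R]natr1 addrK.
have VVge : (N - 1) * ((1 - eta) / N) <= mass mu VV.
  apply: (@le_trans _ _ (mass mu (\bigcup_(c in [set` r]) (setT `&` D c)))).
    rewrite -sr; apply: mass_bigcup_ge => //.
      by move=> c; rewrite setTI; exact: borel_open.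
    by move=> c; exact: mass_core.
  apply: mass_le; last 1 first.
  - move=> x [_ /mapP[p _ ->]]; rewrite setTI => /D_V Vx; exists p => //.
  - by apply: borel_bigcup => // c _; rewrite setTI; exact: borel_open.
  - exact: borel_open.
(* The single row [ord0] already offers enough room. *)
apply: (@lt_le_trans _ _ (n%:R * ((1 - eta) / (q%:R * N)))); last first.
  apply: le_trans (row_mass mu_inv ord0 oO2 FO2) _; apply: mass_le.
  - by apply: borel_bigcup => // c _; apply: borel_open; exact: openI.
  - exact: borel_open.
  - apply: subset_trans (@row_sub O2 ord0) _ => x [[Ox [j j0 Vx]] nB].
    by split => //; split => //; exists (ord0, j).
rewrite -(ltr_pM2l N_gt0); apply: le_lt_trans gap.
have : N * ((N - 1) * ((1 - eta) / N)) <= N * mass mu VV by rewrite ler_pM2l.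
rewrite mulrCA [N * (_ / N)]mulrCA divff ?gt_eqF // mulr1.
have := eta_gt0; nra.
Qed.

(** The left side misses every [D c], so its mass is at most [eta]; the right side contains the part
    of [D None] in [O2]. *)
Lemma array_boundary : subequivalent a (Bd `|` (closure U `&` Rm))
  (O2 `&` ~` closure (VV `|` U)).
Proof.
have cL : closed (Bd `|` (closure U `&` Rm)).
  apply: closedU => //; apply: closedI; first exact: closed_closure.
  exact: open_closedC.
have oT : open (O2 `&` ~` closure (VV `|` U)).
  by apply: openI => //; apply: closed_openC; exact: closed_closure.
apply: a_comparison => // mu mu_inv.
rewrite mass_lt; last 2 first.
- exact: borel_closed.
- exact: borel_open.
have bD : borel (\bigcup_(c in [set` enum C]) (setT `&` D c)).
  by apply: borel_bigcup => // c _; rewrite setTI; exact: borel_open.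
apply: (@le_lt_trans _ _ (mass mu (~` \bigcup_(c in [set` enum C]) (setT `&` D c)))).
  apply: mass_le; [exact: borel_closed|exact: borelC|].
  move=> x Lx [c _ [_ Dx]]; case: Lx.
    by move=> Bx; have : set0 x by rewrite -(Bd_D c).
  by move=> [/closure_U + _]; apply; exact: D_castle Dx.
apply: (@lt_le_trans _ _ ((1 - eta) / (q%:R * N))); last first.
  apply: le_trans (mass_core_cover mu_inv None oO2 FO2) _; apply: mass_le.
  - by apply: borel_open; exact: openI.
  - exact: borel_open.
  - move=> x [Ox Dx]; split => //; rewrite closureU => -[/(D_VV Dx) //|/closure_U].
    by apply; exact: D_castle Dx.
rewrite mass_setC //.
have : (size (enum C))%:R * ((1 - eta) / N) <=
    mass mu (\bigcup_(c in [set` enum C]) (setT `&` D c)).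
  apply: mass_bigcup_ge; rewrite ?enum_uniq //.
    by move=> c; rewrite setTI; exact: borel_open.
  by move=> c; exact: mass_core.
rewrite -cardE -/N mulrCA divff ?gt_eqF // mulr1 => le.
(* What remains is [eta * q * N < 1 - eta], where the left side is 1/4 and [eta <= 1 / 4]. *)
apply: (@le_lt_trans _ _ eta); first by lra.
rewrite ltr_pdivlMr ?mulr_gt0 //.
have := etaP; have := eta_le; nra.
Qed.

Lemma array_squarely_divisible : squarely_divisible_for a O1 O2 E.
Proof.
have u_inj : injective (@Some (I * I)) by move=> p p' [].
exists n, V_, U; split.
- split; first exact: oV_.
    have := @levels_class_equivalent _ _ _ _ C m S V B E' (eta / 2) T sep oB BV E'1 eqT
      (I * I)%type (ord0, ord0) _ u_inj.
    by congr (pairwise_equivalent _ _ _); apply/funext => -[].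
  have := @levels_class_disjoint _ _ _ _ C m S V B E' (eta / 2) T sep BV eqT
    E (I * I)%type _ u_inj EE'.
  by congr (pairwise_disjoint_wrt _ _ _); apply/funext => -[].
- by split; [exact: oU|exact: boundary_U].
- exact: array_row.
- exact: array_remainder.
- exact: array_boundary.
Qed.


End Array.
End Main.

(** * Choice of the constants, and square divisibility for every open set *)

Section Conclusion.
Context (R : realType) (G : groupType) (X : ptopologicalType)
  (a : topAction G X).
Context (G_infinite : infinite_set [set: G]) (X_compact : compact [set: X])
  (X_hausdorff : hausdorff_space X) (a_minimal : minimal_action a)
  (a_URP : uniform_Rokhlin R a) (a_comparison : has_comparison R a).

Lemma mass_setU_le (mu : borel_probability R X) (A B : set X) :
  borel A -> borel B -> mass mu (A `|` B) <= mass mu A + mass mu B.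
Proof.
move=> bA bB; rewrite -lee_fin EFinD -!massE //; last exact: borelU.
exact: measureU2.
Qed.

Lemma square_divisibility (O1 O2 : set X) (E : {fset G}) :
  open O1 -> O1 !=set0 -> open O2 -> O2 !=set0 -> 1%g \in E ->
  squarely_divisible_for a O1 O2 E.
Proof.
move=> oO1 O10 oO2 O20 E1.
have [F1 FO1] := minimal_cover X_compact a_minimal oO1 O10.
have [F2 FO2] := minimal_cover X_compact a_minimal oO2 O20.
pose F := (F1 `|` F2)%fset; pose q := #|` F|.
have q0 : (0 < q)%N.
  rewrite cardfs_gt0; apply/fset0Pn; have [f fF _] := FO1 point.
  by exists f; rewrite inE fF.
(* These constants repeat those of the array construction: [(2 * q).+2] is [n.+1] with
   [n = (2 * q).+1]. *)
pose I := 'I_(2 * q).+2; pose C : finType := option (I * I)%type.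
pose eta : R := (4 * q%:R * #|C|%:R)^-1.
have C0 : (0 < #|C|)%N by rewrite card_option.
have eta0 : 0 < eta / 2 by rewrite divr_gt0 // invr_gt0 !mulr_gt0 // ltr0n.
pose E' := (E `|` F `|` mulfs E F)%fset.
have E'1 : 1%g \in E' by rewrite !in_fsetU E1.
have [K [d' [d'0 KT]]] :=
  exists_equitiling G_infinite a_URP a_comparison C0 E'1 eta0.
have [|m [S [V [B [Z [SK sep oVBZ ZBV remZ]]]]]] :=
  @shrunk_castle R G X a K (Num.min d' (eta / 2)) X_compact X_hausdorff G_infinite
    a_minimal a_URP a_comparison.
  by rewrite lt_min d'0.
have /choice[T eqT] k : exists T : C -> {fset G}, equitiling E' (eta / 2) (S k) T.
  have [S0 KS] := SK k; apply: KT => //.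
  apply: le_trans KS; rewrite ler_wpM2r // lerD2l lerN2.
  by rewrite ge_min lexx.
apply: (@array_squarely_divisible R G X a a_comparison q F E O1 O2 q0 (leqnn _) E1
  oO1 oO2 _ _ m S V B Z T sep _ _ _ _ _ eqT).
- by move=> x; have [f fF Of] := FO1 x; exists f; rewrite // inE fF.
- by move=> x; have [f fF Of] := FO2 x; exists f; rewrite // inE fF orbT.
- by move=> k; have [] := oVBZ k.
- by move=> k; have [] := oVBZ k.
- by move=> k; have [] := oVBZ k.
- by move=> k; have [] := ZBV k.
- by move=> k; have [] := ZBV k.
- move=> mu mu_inv; apply: le_trans (remZ mu mu_inv) _.
  by rewrite ge_min lexx orbT.
Qed.

(** By minimality some [f] sends a given point of [P] into a small open set [D]; a neighbourhood
    with closure in [P] and in [f^-1 D] has the small mass by invariance. *)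
Lemma small_open_in (P : set X) (e : R) : open P -> P !=set0 -> 0 < e ->
  exists Q, [/\ open Q, Q !=set0, closure Q `<=` P &
    uniformly_le a (closure Q) e].
Proof.
move=> oP [p Pp] e0.
have [D [oD D0 De]] := small_open G_infinite a_URP a_comparison e0.
have [F FD] := minimal_cover X_compact a_minimal oD D0.
have [f _ Dfp] := FD p.
have oW : open (P `&` a f @^-1` D).
  apply: openI => //; apply: open_comp => // x _; exact: act_continuous.
have [||Q [oQ pQ QW]] := @compact_shrink X [set p] _ X_hausdorff X_compact _ oW.
- exact/accessible_closed_set1/hausdorff_accessible.
- by move=> _ ->.
exists Q; split => //; first by exists p; exact: pQ.
  by move=> x /QW[].
move=> mu mu_inv; apply: le_trans (De mu mu_inv).
rewrite -(mass_act mu_inv f); last by apply: borel_closed; exact: closed_closure.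
apply: mass_le.
- by apply: borel_act; apply: borel_closed; exact: closed_closure.
- exact: borel_open.
- by move=> _ [x /QW[_ Dx] <-].
Qed.

Lemma square_divisibility_all : squarely_divisible a.
Proof.
move=> O oO On.
have [mu mu_inv] := exists_invariant a_comparison.
have cl (A : set X) : borel (closure A).
  by apply: borel_closed; exact: closed_closure.
have nonfull (A : set X) : borel A -> mass mu A < 1 -> ~` A !=set0.
  move=> bA; rewrite ltNge => /negP lt; apply/set0P/eqP => A0; apply: lt.
  by rewrite -[A]setCK A0 setC0 mass_setT.
have [|O0 [oO0 O00 O0O O0e]] := @small_open_in O (1 / 4) oO On; first by lra.
have [F FO] := minimal_cover X_compact a_minimal oO0 O00.
have F0 : 0 < #|` F|%:R :> R.
  by rewrite ltr0n cardfs_gt0; apply/fset0Pn; have [f fF _] := FO point; exists f.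
pose c : R := #|` F|%:R^-1.
have c0 : 0 < c by rewrite invr_gt0.
have cO0 (nu : borel_probability R X) : invariant_measures a nu -> c <= mass nu O0.
  move=> nu_inv; rewrite -(ler_pM2l F0) divff ?gt_eqF // -[leLHS](mass_setT nu).
  apply: (mass_cover nu_inv) => [||x _]; last exact: FO.
    by apply: borel_open; exact: openT.
  exact: borel_open.
(* The bound [c / 4] makes the two closures together lighter than [O0]; the bound 1/4 keeps the
   closures chosen so far below full mass, so that their complement is nonempty. *)
pose e := Num.min (1 / 4) (c / 4).
have e0 : 0 < e by rewrite lt_min !divr_gt0.
have e1 : e <= 1 / 4 by rewrite ge_min lexx.
have ec : e <= c / 4 by rewrite ge_min lexx orbT.
have [||O1 [oO1 O10 O1s O1e]] := @small_open_in (~` closure O0) e _ _ e0.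
- by apply: closed_openC; exact: closed_closure.
- by apply: nonfull => //; have := O0e mu mu_inv; lra.
have [||O2 [oO2 O20 O2s O2e]] := @small_open_in (~` (closure O0 `|` closure O1))
  e _ _ e0.
- by apply: closed_openC; apply: closedU; exact: closed_closure.
- apply: nonfull; first exact: borelU.
  have := mass_setU_le mu (cl O0) (cl O1).
  have := O0e mu mu_inv; have := O1e mu mu_inv; lra.
exists O0, O1, O2; split=> //.
- by move=> x /subset_closure /O0O.
- split; apply/seteqP; split=> // x [].
  + by move=> c0x /O1s; apply.
  + by move=> c0x /O2s; apply; left.
  + by move=> c1x /O2s; apply; right.
- split; last by move=> E E1; exact: square_divisibility.
  apply: a_comparison => //; first by apply: closedU; exact: closed_closure.
  move=> nu nu_inv; rewrite mass_lt; last 2 first.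
  + exact: borelU.
  + exact: borel_open.
  have := mass_setU_le nu (cl O1) (cl O2); have := cO0 nu nu_inv.
  have := O1e nu nu_inv; have := O2e nu nu_inv; lra.
Qed.

End Conclusion.

(** Metrizability is expressed by a pseudometric together with [hausdorff_space]; the structure is
    pointed, so [X] is nonempty. *)
Theorem theorem5p7 (R : realType) (G : groupType) (X : pseudoPMetricType R)
    (a : topAction G X)
    (G_infinite : infinite_set [set: G])
    (G_countable : countable [set: G])
    (G_amenable : amenable R G)
    (X_compact : compact [set: X])
    (X_hausdorff : hausdorff_space X)
    (a_minimal : minimal_action a)
    (a_URP : uniform_Rokhlin R a)
    (a_comparison : has_comparison R a) :
  (forall (O1 O2 : set X) (E : {fset G}),
     open O1 -> O1 !=set0 -> open O2 -> O2 !=set0 -> 1%g \in E ->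
     squarely_divisible_for a O1 O2 E) /\
  squarely_divisible a.
Proof.
split=> [? ? ?|].
  exact: (square_divisibility G_infinite X_compact X_hausdorff a_minimal
    a_URP a_comparison).
exact: (square_divisibility_all G_infinite X_compact X_hausdorff a_minimal
  a_URP a_comparison).
Qed.
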